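(* Let $(\Omega,\mathcal A,\mathbb P,\{\mathcal F_n\}_{n\ge 0})$ be a filtered probability space, $\Theta\subseteq\mathbb R^d$, $h:\Theta\to\mathbb R^d$ measurable, $\{\gamma_n\}_{n\ge1}$ a deterministic positive sequence, $\{e_n\}_{n\ge1}$, $\{r_n\}_{n\ge1}$ $\mathbb R^d$-valued random variables, and $\{\theta_n\}_{n\ge0}$ the $\Theta$-valued sequence with $\theta_0\in\Theta$ and $\theta_{n+1}=\theta_n+\gamma_{n+1}h(\theta_n)+\gamma_{n+1}e_{n+1}+\gamma_{n+1}r_{n+1}$. Let $\bar\theta_n=\frac1{n+1}\sum_{k=0}^n\theta_k$. Let $\theta_\star\in\Theta$, $\mathcal L=\{\lim_q\theta_q=\theta_\star\}$, and assume (C1), (C4a), (AV1), (AV2), (AV3) (defined in the context). Then for every $t\in\mathbb R^d$, $$\lim_n\mathbb E\left[\mathbf 1_{\mathcal L}\exp\left(i\sqrt n\,t^T(\bar\theta_n-\theta_\star)\right)\right]=\mathbb E\left[\mathbf 1_{\mathcal L}\exp\left(-\tfrac12t^T\nabla h(\theta_\star)^{-1}U_\star(\nabla h(\theta_\star)^{-1})^Tt\right)\right].$$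
   Context: $|\cdot|$ is the Euclidean norm; $x^T$ transpose. Order notation for random sequences $Z_n$: $Z_n=O_{w.p.1}(1)$ means $\sup_n|Z_n|<\infty$ a.s.; $Z_n=O_{L^2}(1)$ means $\sup_n\mathbb E|Z_n|^2<\infty$; $Z_n=O_{w.p.1}(1)O_{L^2}(1)$ means $Z_n=W_n\bar W_n$ with $W_n=O_{w.p.1}(1)$, $\bar W_n=O_{L^2}(1)$. (C1) (a) $\theta_\star$ is in the interior of $\Theta$ and $h(\theta_\star)=0$; (b) $h$ is twice continuously differentiable in a neighborhood of $\theta_\star$; (c) $\nabla h(\theta_\star)$ is Hurwitz (all eigenvalues have negative real part). (C4a) $\sum_k\gamma_k=\infty$, $\sum_k\gamma_k^2<\infty$ and $\log(\gamma_{k-1}/\gamma_k)=o(\gamma_k)$. (AV1) (a) $e_n$ is $\mathcal F_n$-measurable and $\mathbb E[e_n\mid\mathcal F_{n-1}]=0$ a.s. (b) There is a sequence of sets $\{\mathcal A_m\}_{m\ge1}$ with $\lim_m\mathbb P(\mathcal A_m\mid\mathcal L)=1$ and, for each $m$, sets $\mathcal A_{m,k}\in\mathcal F_k$ with $\sup_k\mathbb E[|e_k|^2\mathbf 1_{\mathcal A_{m,k-1}}]<\infty$ and $\lim_k\mathbf 1_{\mathcal A_{m,k}}=\mathbf 1_{\mathcal A_m}$ a.s. on $\mathcal L$. (c) With $\mathcal E_{n+1}=(n+1)^{-1/2}\sum_{k=0}^ne_{k+1}$, there is a random matrix $U_\star$, positive definite a.s. on $\mathcal L$, such that for every $t\in\mathbb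 R^d$, $\lim_n\mathbb E[\mathbf 1_{\mathcal L}\exp(it^T\mathcal E_{n+1})]=\mathbb E[\mathbf 1_{\mathcal L}\exp(-\frac12t^TU_\star t)]$. (AV2) $r_n$ is $\mathcal F_n$-measurable, $r_n=r_n^{(1)}+r_n^{(2)}$ with, for every $m\ge1$: (a) $\gamma_n^{-1/2}r_n^{(1)}\mathbf 1_{\mathcal L}\mathbf 1_{\mathcal A_m}=O_{w.p.1}(1)O_{L^2}(1)$; (b) $\sqrt{\gamma_n}\sum_{k=1}^nr_k^{(2)}\mathbf 1_{\mathcal L}\mathbf 1_{\mathcal A_m}=O_{w.p.1}(1)O_{L^2}(1)$; (c) $n^{-1/2}\sum_{k=0}^nr_{k+1}\mathbf 1_{\mathcal L}\to0$ in probability. (AV3) $\lim_n n\gamma_n=+\infty$, $\lim_n n^{-1/2}\sum_{k=1}^n\gamma_k^{-1/2}|1-\gamma_k/\gamma_{k+1}|=0$ and $\lim_nn^{-1/2}\sum_{k=1}^n\gamma_k=0$. *)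

(* Defs.v *)
From HB Require Import structures.
From mathcomp Require Import all_boot all_order all_algebra.
From mathcomp Require Import all_classical all_reals all_analysis.
From mathcomp.real_closed Require Import complex.

Set Implicit Arguments.
Unset Strict Implicit.
Unset Printing Implicit Defensive.

Import Order.TTheory GRing.Theory Num.Theory.
Import numFieldNormedType.Exports.

Local Open Scope classical_set_scope.
Local Open Scope ring_scope.

Definition enorm (R : realType) (d : nat) (x : 'rV[R]_d) : R :=
  Num.sqrt (\sum_(i < d) x 0 i ^+ 2).

Definition dotp (R : realType) (d : nat) (s x : 'rV[R]_d) : R := (s *m x^T) 0 0.

Definition qform (R : realType) (d : nat) (M : 'M[R]_d) (t : 'rV[R]_d) : R :=
  (t *m M *m t^T) 0 0.

Definition borel_of (U : topologicalType) : set (set U) :=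
  <<s [set B : set U | open B] >>.

Definition meas_wrt (T : Type) (G : set (set T)) (U : topologicalType)
  (X : T -> U) : Prop :=
  forall B, borel_of B -> G (X @^-1` B).

Definition meas_on_dom (U V : topologicalType) (D : set U) (f : U -> V) : Prop :=
  forall B, borel_of B -> exists C, borel_of C /\ D `&` f @^-1` B = D `&` C.

Definition filtration (dT : measure_display) (T : measurableType dT)
  (F : nat -> set (set T)) : Prop :=
  (forall n, sigma_algebra setT (F n)) /\
  (forall n, F n `<=` measurable) /\
  (forall n, F n `<=` F n.+1).

(** E[e_n | F_{n-1}] = 0 a.s. for all n >= 1 (integrability and the defining
    property of conditional expectation, componentwise). *)
Definition cond_mean_zero (dT : measure_display) (T : measurableType dT)
  (R : realType) (d : nat) (P : probability T R) (F : nat -> set (set T))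
  (e : nat -> T -> 'rV[R]_d) : Prop :=
  forall n, (0 < n)%N -> forall i : 'I_d,
    P.-integrable setT (fun w => (e n w 0 i)%:E) /\
    forall B, F n.-1 B -> (\int[P]_(w in B) (e n w 0 i)%:E = 0)%E.

Definition OwpOL2 (dT : measure_display) (T : measurableType dT)
  (R : realType) (d : nat) (P : probability T R) (Z : nat -> T -> 'rV[R]_d) : Prop :=
  exists (W : nat -> T -> R) (Wb : nat -> T -> 'rV[R]_d),
    (forall n, meas_wrt measurable (W n) /\ meas_wrt measurable (Wb n)) /\
    (forall n, (0 < n)%N -> forall w, Z n w = W n w *: Wb n w) /\
    {ae P, forall w, exists M : R, forall n, (0 < n)%N -> `|W n w| <= M} /\
    exists M : R, forall n, (0 < n)%N ->
      (\int[P]_w ((enorm (Wb n w)) ^+ 2)%:E <= M%:E)%E.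

Definition cvg_in_prob (dT : measure_display) (T : measurableType dT)
  (R : realType) (d : nat) (P : probability T R) (Z : nat -> T -> 'rV[R]_d) : Prop :=
  forall eps : R, 0 < eps ->
    (fun n => P [set w | eps < enorm (Z n w)]) @ \oo --> 0%E.

(** lim_n E[1_L exp(i Y_n)] = E[1_L V]  for real V, written through the real
    and imaginary parts of the complex expectation. *)
Definition cexp_lim (dT : measure_display) (T : measurableType dT)
  (R : realType) (P : probability T R) (L : set T) (Y : nat -> T -> R)
  (V : T -> R) : Prop :=
  ((fun n => (\int[P]_w ((\1_L w : R) * cos (Y n w))%:E)%E) @ \oo
      --> (\int[P]_w ((\1_L w : R) * V w)%:E)%E) /\
  ((fun n => (\int[P]_w ((\1_L w : R) * sin (Y n w))%:E)%E) @ \oo --> 0%E).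

Definition posdef (R : realType) (d : nat) (U : 'M[R]_d) : Prop :=
  forall x : 'rV[R]_d, x != 0 -> 0 < qform U x.

Definition hurwitz (R : realType) (d : nat) (A : 'M[R]_d) : Prop :=
  forall z : R[i], eigenvalue (map_mx (fun x => (x%:C)%C) A) z -> 'Re z < 0.

(** Gradient (Jacobian) matrix, usual convention: (grad h x)_{ij} = d h_i / d x_j.
    (The library's [jacobian] is lin1_mx of the differential, i.e. the transpose.) *)
Definition grad (R : realType) (d : nat) (h : 'rV[R]_d -> 'rV[R]_d) (x : 'rV[R]_d)
  : 'M[R]_d := (jacobian h x)^T.

Definition C2_on (R : realType) (d : nat) (V : set 'rV[R]_d)
  (h : 'rV[R]_d -> 'rV[R]_d) : Prop :=
  (forall x, V x -> differentiable h x) /\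
  (forall x, V x -> differentiable (jacobian h) x) /\
  (forall x, V x -> forall v : 'rV[R]_d,
     {for x, continuous (fun y => 'd (jacobian h) y v)}).

Fixpoint sa_iter (R : realType) (d : nat) (T : Type) (h : 'rV[R]_d -> 'rV[R]_d)
  (gam : nat -> R) (e r : nat -> T -> 'rV[R]_d) (th0 : 'rV[R]_d) (n : nat)
  : T -> 'rV[R]_d :=
  match n with
  | 0 => fun _ => th0
  | n'.+1 => fun w =>
      let x := sa_iter h gam e r th0 n' w in
      x + gam n'.+1 *: h x + gam n'.+1 *: e n'.+1 w + gam n'.+1 *: r n'.+1 w
  end.

Definition avg_iter (R : realType) (d : nat) (T : Type) (theta : nat -> T -> 'rV[R]_d)
  (n : nat) (w : T) : 'rV[R]_d :=
  (n.+1%:R)^-1 *: \sum_(k < n.+1) theta k w.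

(* Main.v *)
(** Write [D n = theta n - ths] and [h (theta n) = D n *m J + rho n], where [J]
    is the (transposed) gradient at [ths] and [rho n = O(|D n|^2)].  Dividing the
    recursion by its step sizes, summing, and summing by parts,
    [(\sum_k D k) *m J] is [- \sum_k e k.+1] up to [- \sum_k r k.+1], the sum of
    the [rho k], and terms in which [D k] is multiplied by an increment of [1 / g].
    These errors are negligible after division by [sqrt n] as soon as
    [|D n|^2 <= M(w) * g n * eta n w] with a random finite [M] and a bounded
    expectation for [eta n].  To get this rate, [D n] is split into three parts:
    the linear recursion driven by the truncated noise, whose second moment is
    contracted in a Lyapunov norm of [J] because the noise is orthogonal to the
    past; [g n *: \sum_k r2 k]; and a remainder, to which the same contraction
    applies path by path.  The limit is then transferred from the normalised noise
    since [cos] and [sin] are bounded and 1-Lipschitz. *)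

Require Import Defs.
From HB Require Import structures.
From mathcomp Require Import all_boot all_order all_algebra.
From mathcomp Require Import all_classical all_reals all_analysis.
From mathcomp.real_closed Require Import complex.
From mathcomp Require Import measurable_realfun.
From mathcomp Require Import ring lra zify.

Import Order.TTheory GRing.Theory Num.Theory.
Import numFieldNormedType.Exports.

Set Implicit Arguments.
Unset Strict Implicit.
Unset Printing Implicit Defensive.

Local Open Scope classical_set_scope.
Local Open Scope ring_scope.

(** * Squared Euclidean norm *)

Section SquaredNorm.
Variable R : realType.

(** Two features shape the argument. [L] is not an event of the past, so orthogonality of the noise
    cannot be used under its indicator; and second moments of the noise are bounded only after
    multiplication by the indicator of [Ak n.-1], which keeps the noise centred given the past. The
    quadratic remainder, in turn, is small only along a path of [L], from a random time on. Hence
    two kinds of bounds are kept apart: [chi], [xi], [eta] and [zeta] live on the whole space and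
    have controlled expectations, while all that depends on the path (starting time, bounds on the
    [W] factors, size of the remainder) goes into [M(w)], of which neither a moment nor
    measurability is known. A product of [M(w)] with a sequence vanishing in mean is still small in
    probability, which is enough for bounded Lipschitz functions. The rate [g n] for [|D n|^2] is
    the one that turns the error sums into those of the step-size conditions: [1 / sqrt (n * g n)]
    for the boundary term, [|1 - g k / g k.+1| / sqrt (g k)] for the increments, [g k] for the
    remainder. *)

Lemma le_of_eq (x y : R) : x = y -> x <= y.
Proof. by move=> ->. Qed.

Definition sqn n (x : 'rV[R]_n) : R := \sum_(i < n) x 0 i ^+ 2.

Lemma sqn_ge0 n (x : 'rV[R]_n) : 0 <= sqn x.
Proof. by apply: sumr_ge0 => i _; apply: sqr_ge0. Qed.

Lemma enorm_sqr n (x : 'rV[R]_n) : enorm x ^+ 2 = sqn x.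
Proof. by rewrite sqr_sqrtr// sqn_ge0. Qed.

Lemma sqn0 n : sqn (0 : 'rV[R]_n) = 0.
Proof. by rewrite /sqn big1// => i _; rewrite mxE expr0n. Qed.

Lemma sqnZ n c (x : 'rV[R]_n) : sqn (c *: x) = c ^+ 2 * sqn x.
Proof. by rewrite /sqn mulr_sumr; apply: eq_bigr => i _; rewrite mxE exprMn. Qed.

Lemma sqn_coord n (x : 'rV[R]_n) i : x 0 i ^+ 2 <= sqn x.
Proof.
rewrite /sqn (bigD1 i)//= lerDl; apply: sumr_ge0 => j _; exact: sqr_ge0.
Qed.

Lemma dotpE n (x y : 'rV[R]_n) : dotp x y = \sum_i x 0 i * y 0 i.
Proof. by rewrite /dotp mxE; apply: eq_bigr => i _; rewrite mxE. Qed.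

Lemma dotpDr n (x y z : 'rV[R]_n) : dotp x (y + z) = dotp x y + dotp x z.
Proof. by rewrite /dotp linearD mulmxDr mxE. Qed.

Lemma dotpZr n c (x y : 'rV[R]_n) : dotp x (c *: y) = c * dotp x y.
Proof. by rewrite /dotp linearZ /= -scalemxAr mxE. Qed.

Lemma dotp_mulmx n (x y : 'rV[R]_n) (M : 'M[R]_n) :
  dotp x (y *m M) = dotp (x *m M^T) y.
Proof. by rewrite /dotp trmx_mul mulmxA. Qed.

Lemma sqnD n (x y : 'rV[R]_n) : sqn (x + y) = sqn x + 2 * dotp x y + sqn y.
Proof.
rewrite dotpE /sqn mulr_sumr -!big_split/=; apply: eq_bigr => i _.
by rewrite mxE; ring.
Qed.

(** Young's inequality with a free weight: in each coordinate the gap is a perfect square. A small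
    [s] keeps the factor of [sqn x] near 1, so that a contraction of [x] survives the perturbation
    [y]. *)
Lemma sqnD_le n (x y : 'rV[R]_n) s : 0 < s -> s < 1 ->
  sqn (x + y) <= sqn x / (1 - s) + sqn y / s.
Proof.
move=> s0 s1; rewrite /sqn !mulr_suml -big_split/=; apply: ler_sum => i _.
rewrite mxE; set a := x 0 i; set b := y 0 i.
have s1' : 0 < 1 - s by rewrite subr_gt0.
rewrite -subr_ge0.
have -> : a ^+ 2 / (1 - s) + b ^+ 2 / s - (a + b) ^+ 2 =
  (s * a - (1 - s) * b) ^+ 2 / (s * (1 - s)).
  by field; rewrite !gt_eqF.
by rewrite divr_ge0 ?sqr_ge0// mulr_ge0 ?ltW.
Qed.

Lemma sqnD_le2 n (x y : 'rV[R]_n) : sqn (x + y) <= 2 * (sqn x + sqn y).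
Proof.
have h0 : 0 < 2^-1 :> R by rewrite invr_gt0.
have h1 : 2^-1 < 1 :> R by rewrite invf_lt1// ltr1n.
apply: le_trans (sqnD_le x y h0 h1) _.
have -> : 1 - 2^-1 = 2^-1 :> R by field.
by rewrite invrK; lra.
Qed.

(** Cauchy-Schwarz against the constant vector, by expanding the nonnegative double sum of
    [(F i - F j) ^+ 2]. *)
Lemma sqr_sum_le (I : finType) (F : I -> R) :
  (\sum_i F i) ^+ 2 <= #|I|%:R * \sum_i F i ^+ 2.
Proof.
have h : 0 <= \sum_i \sum_j (F i - F j) ^+ 2.
  by apply: sumr_ge0 => i _; apply: sumr_ge0 => j _; exact: sqr_ge0.
have e : \sum_i \sum_j (F i - F j) ^+ 2 =
    2 * (#|I|%:R * \sum_i F i ^+ 2) - 2 * (\sum_i F i) ^+ 2.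
  have -> : \sum_i \sum_j (F i - F j) ^+ 2 =
      \sum_i (#|I|%:R * F i ^+ 2 + \sum_j F j ^+ 2 - 2 * (F i * \sum_j F j)).
    apply: eq_bigr => i _.
    have -> : #|I|%:R * F i ^+ 2 = \sum_(j : I) F i ^+ 2.
      by rewrite sumr_const mulr_natl.
    by rewrite !mulr_sumr -big_split/= -sumrB; apply: eq_bigr => j _; ring.
  rewrite sumrB big_split/= -!mulr_sumr -mulr_suml sumr_const -mulr_natl.
  by rewrite expr2; ring.
by rewrite e in h; lra.
Qed.

(** The constant is returned as data, to be used in definitions, and the added 1 makes it positive,
    to be divided by. *)
Lemma sqn_mulmx n p (M : 'M[R]_(n, p)) :
  {C | 0 < C & forall x : 'rV[R]_n, sqn (x *m M) <= C * sqn x}.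
Proof.
pose C := 1 + n%:R * \sum_(j < p) \sum_(i < n) M i j ^+ 2.
exists C.
  by rewrite /C ltr_pwDl// mulr_ge0// sumr_ge0// => j _; rewrite sumr_ge0// => i _; exact: sqr_ge0.
move=> x; rewrite {1}/sqn.
apply: (@le_trans _ _ (\sum_(j < p) n%:R * \sum_(i < n) M i j ^+ 2 * sqn x)).
  apply: ler_sum => j _; rewrite mxE.
  apply: le_trans (sqr_sum_le _) _; rewrite card_ord ler_wpM2l//.
  apply: ler_sum => i _; rewrite exprMn mulrC ler_wpM2l ?sqr_ge0//.
  exact: sqn_coord.
rewrite -mulr_sumr; under eq_bigr do rewrite -mulr_suml.
rewrite -mulr_suml /C mulrDl mul1r mulrA lerDr; exact: sqn_ge0.
Qed.

Lemma norm_sqn_le n (x : 'rV[R]_n) : `|x| ^+ 2 <= sqn x.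
Proof.
rewrite -[leRHS]sqr_sqrtr ?sqn_ge0// ler_sqr ?nnegrE ?sqrtr_ge0//.
rewrite [leLHS]/Num.norm/= mx_normrE; apply/bigmax_leP; split => /=.
  exact: sqrtr_ge0.
move=> [i j] _ /=; rewrite ord1 -sqrtr_sqr; apply: ler_wsqrtr; exact: sqn_coord.
Qed.

Lemma coord_norm_le n (x : 'rV[R]_n) i : `|x 0 i| <= `|x|.
Proof.
rewrite [leRHS]/Num.norm/= mx_normrE; apply: (@le_bigmax _ _ _ _ _ (0, i)).
Qed.

Lemma sqn_le_norm n (x : 'rV[R]_n) : sqn x <= n%:R * `|x| ^+ 2.
Proof.
apply: (@le_trans _ _ (\sum_(i < n) `|x| ^+ 2)).
  apply: ler_sum => i _; rewrite -real_normK ?num_real//.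
  by rewrite ler_sqr ?nnegrE//; exact: coord_norm_le.
by rewrite sumr_const card_ord mulr_natl.
Qed.

Lemma dotp_le_norm n (t : 'rV[R]_n) :
  {C | 0 < C & forall x, `|dotp t x| <= C * `|x|}.
Proof.
exists (1 + \sum_i `|t 0 i|).
  by rewrite ltr_pwDl// sumr_ge0.
move=> x; rewrite dotpE; apply: le_trans (ler_norm_sum _ _ _) _.
apply: (@le_trans _ _ (\sum_i `|t 0 i| * `|x|)).
  by apply: ler_sum => i _; rewrite normrM ler_wpM2l// coord_norm_le.
by rewrite -mulr_suml mulrDl mul1r lerDr.
Qed.

End SquaredNorm.

(** * A Lyapunov norm for a Hurwitz matrix *)

Section Lyapunov.
Variable R : realType.

(* [u] and [v] are the real and imaginary parts of a complex row vector, [T1] and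
   [T2] those of a triangular matrix.  Geometric weights make the contribution of
   the off-diagonal entries as small as needed. *)
Lemma triangular_dissipative d (T1 T2 : 'M[R]_d) a : 0 < a ->
  (forall i j : 'I_d, (i < j)%N -> T1 i j = 0) ->
  (forall i j : 'I_d, (i < j)%N -> T2 i j = 0) ->
  (forall i, T1 i i <= - (2 * a)) ->
  exists2 w : 'I_d -> R, (forall i, 0 < w i) &
  forall u v : 'rV[R]_d,
    \sum_j w j ^+ 2 * (u 0 j * (u *m T1 - v *m T2) 0 j + v 0 j * (u *m T2 + v *m T1) 0 j)
    <= - a * \sum_j w j ^+ 2 * (u 0 j ^+ 2 + v 0 j ^+ 2).
Proof.
move=> a0 T10 T20 T1d.
pose K : R := 1 + `|T1| + `|T2|.
have K0 : 0 < K by rewrite /K -addrA ltr_pwDl// addr_ge0.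
have coordK (M : 'M[R]_d) i j : `|M i j| <= `|M|.
  by rewrite [leRHS]/Num.norm/= mx_normrE; apply: (@le_bigmax _ _ _ _ _ (i, j)).
have T1K i j : `|T1 i j| <= K.
  by apply: le_trans (coordK _ _ _) _; rewrite /K; have := normr_ge0 T2; lra.
have T2K i j : `|T2 i j| <= K.
  by apply: le_trans (coordK _ _ _) _; rewrite /K; have := normr_ge0 T1; lra.
pose D : R := d%:R + 1.
have D0 : 0 < D by rewrite /D ltr_wpDl.
(* Weight in the Young inequality for products of entries at [j] and [i]: the part that stays at
   [j], summed over [i], costs at most [a / 2]. *)
pose kap := a / (2 * D * K).
have kap0 : 0 < kap by rewrite /kap divr_gt0// !mulr_gt0.
(* Ratio of consecutive weights: the part [K * (q i / kap)] with [j < i] gains a factor [del], since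
   [w j ^+ 2 <= del * w i ^+ 2], and costs another [a / 2]. Of the diagonal margin [2 * a], [a] is
   left. *)
pose del := Num.min 1 (a / (2 * D * (K / kap))).
have del0 : 0 < del.
  by rewrite /del lt_min ltr01/= divr_gt0// !mulr_gt0// invr_gt0.
have del1 : del <= 1 by rewrite /del ge_min lexx.
have delE : D * (K / kap) * del <= a / 2.
  apply: (@le_trans _ _ (D * (K / kap) * (a / (2 * D * (K / kap))))).
    rewrite ler_wpM2l//; first by rewrite mulr_ge0 ?ltW// divr_gt0.
    by rewrite /del ge_min lexx orbT.
  apply: le_of_eq; by field; rewrite !gt_eqF.
exists (fun j : 'I_d => del ^+ (d - j)) => [i|u v]; first exact: exprn_gt0.
pose q (j : 'I_d) : R := u 0 j ^+ 2 + v 0 j ^+ 2.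
pose w (j : 'I_d) := del ^+ (d - j).
rewrite -/q -/w.
have q0 j : 0 <= q j by rewrite addr_ge0 ?sqr_ge0.
have w0 j : 0 < w j by exact: exprn_gt0.
have wle (i j : 'I_d) : (j < i)%N -> w j ^+ 2 <= del * w i ^+ 2.
  move=> ji; rewrite /w -!exprM -exprS ler_wiXn2l ?(ltW del0) ?del1//.
  have := ltn_ord i; have := ltn_ord j => *.
  have h : (d - i < d - j)%N by rewrite ltn_sub2l// (ltn_trans ji).
  by rewrite !muln2 ltn_double.
pose c (j i : 'I_d) := T1 i j * (u 0 j * u 0 i + v 0 j * v 0 i)
   + T2 i j * (v 0 j * u 0 i - u 0 j * v 0 i).
have cE j : u 0 j * (u *m T1 - v *m T2) 0 j + v 0 j * (u *m T2 + v *m T1) 0 j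
     = \sum_i c j i.
  rewrite !mxE -sumrB -big_split/= !mulr_sumr -big_split/=.
  by apply: eq_bigr => i _; rewrite /c; ring.
have cd j : c j j <= - (2 * a) * q j.
  have -> : c j j = T1 j j * q j by rewrite /c /q; ring.
  by rewrite ler_wpM2r.
have AMGM (x y x' y' : R) : `|x * x' + y * y'| <=
    2^-1 * (kap * (x ^+ 2 + y ^+ 2) + (x' ^+ 2 + y' ^+ 2) / kap).
  rewrite ler_norml; apply/andP; split; rewrite -subr_ge0.
    have -> : x * x' + y * y' - - (2^-1 * (kap * (x ^+ 2 + y ^+ 2) + (x' ^+ 2 + y' ^+ 2) / kap)) =
      2^-1 * ((kap * x + x') ^+ 2 + (kap * y + y') ^+ 2) / kap.
      by field; rewrite gt_eqF.
    by rewrite divr_ge0 ?(ltW kap0)// mulr_ge0// addr_ge0 ?sqr_ge0.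
  have -> : 2^-1 * (kap * (x ^+ 2 + y ^+ 2) + (x' ^+ 2 + y' ^+ 2) / kap) - (x * x' + y * y') =
    2^-1 * ((kap * x - x') ^+ 2 + (kap * y - y') ^+ 2) / kap.
    by field; rewrite gt_eqF.
  by rewrite divr_ge0 ?(ltW kap0)// mulr_ge0// addr_ge0 ?sqr_ge0.
have coff j i : c j i <= K * (kap * q j + q i / kap).
  apply: le_trans (ler_norm _) _; apply: le_trans (ler_normD _ _) _.
  have h1 := AMGM (u 0 j) (v 0 j) (u 0 i) (v 0 i).
  have h2 := AMGM (v 0 j) (- u 0 j) (u 0 i) (v 0 i).
  rewrite !normrM mulNr sqrrN in h1 h2 *.
  have g1 : `|T1 i j| * `|u 0 j * u 0 i + v 0 j * v 0 i| <=
     K * (2^-1 * (kap * q j + q i / kap)) by apply: ler_pM.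
  have g2 : `|T2 i j| * `|v 0 j * u 0 i - u 0 j * v 0 i| <=
     K * (2^-1 * (kap * q j + q i / kap)).
    by apply: ler_pM => //; apply: le_trans h2 _; rewrite /q addrC [u 0 j ^+ 2 + _]addrC addrC.
  by apply: le_trans (lerD g1 g2) _; apply: le_of_eq; field; rewrite gt_eqF.
have Kk : 0 <= K * kap by rewrite mulr_ge0// ltW.
have Kd : 0 <= del * (K / kap) by rewrite !mulr_ge0 ?invr_ge0// ltW.
have wq i : 0 <= w i ^+ 2 * q i by rewrite mulr_ge0// sqr_ge0.
have termle j : w j ^+ 2 * \sum_i c j i <=
   - (2 * a) * (w j ^+ 2 * q j) + d%:R * (K * kap) * (w j ^+ 2 * q j)
   + \sum_i del * (K / kap) * (w i ^+ 2 * q i).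
  have S : \sum_i c j i <= - (2 * a) * q j +
      \sum_(i | i != j) (if (j < i)%N then K * (kap * q j + q i / kap) else 0).
    rewrite (bigD1 j)//= lerD//; apply: ler_sum => i ij; case: ifPn => // ji.
    have {}ij : (i < j)%N by rewrite ltn_neqAle ij leqNgt.
    by rewrite /c T10// T20// !mul0r addr0.
  apply: le_trans (ler_wpM2l (sqr_ge0 _) S) _.
  rewrite mulrDr -addrA lerD//; first by rewrite mulrCA.
  rewrite mulr_sumr.
  apply: (@le_trans _ _ (\sum_i ((K * kap) * (w j ^+ 2 * q j) + del * (K / kap) * (w i ^+ 2 * q i)))).
    rewrite [leRHS](bigD1 j)//= ler_wpDl//.
      by apply: addr_ge0; apply: mulr_ge0.
    apply: ler_sum => i _; case: ifPn => ji; last first.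
      by rewrite mulr0; apply: addr_ge0; apply: mulr_ge0.
    rewrite mulrDr mulrDr lerD//; first by apply: le_of_eq; ring.
    have -> : del * (K / kap) * (w i ^+ 2 * q i) = (del * w i ^+ 2) * (K * (q i / kap)).
      by ring.
    apply: ler_wpM2r; last exact: wle.
    by apply: mulr_ge0; [exact: ltW|apply: divr_ge0 => //; exact: ltW].
  by rewrite big_split/= sumr_const card_ord -[in leLHS]mulr_natl mulrA.
rewrite (eq_bigr (fun j => w j ^+ 2 * \sum_i c j i)); last by move=> j _; rewrite cE.
apply: le_trans (ler_sum _ (fun j _ => termle j)) _.
rewrite !big_split/= -!mulr_sumr sumr_const card_ord.
set V := \sum_i w i ^+ 2 * q i; rewrite -[V *+ d]mulr_natl.
have V0 : 0 <= V by apply: sumr_ge0 => i _; rewrite mulr_ge0// sqr_ge0.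
have hk : d%:R * (K * kap) <= a / 2.
  apply: (@le_trans _ _ (D * (K * kap))).
    by apply: ler_wpM2r => //; rewrite /D lerDl.
  by apply: le_of_eq; rewrite /kap; field; rewrite !gt_eqF.
have hd : d%:R * (del * (K / kap)) <= a / 2.
  apply: le_trans delE; rewrite -mulrA [K / kap * del]mulrC.
  by apply: ler_wpM2r => //; rewrite /D lerDl.
have h1 := ler_wpM2r V0 hk; have h2 := ler_wpM2r V0 hd.
by lra.
Qed.

End Lyapunov.

(** * A real Lyapunov norm from the complex Schur form *)

Section HurwitzLyapunov.
Variable R : realType.

Lemma complexRe_sum (I : finType) (F : I -> R[i]) :
  complex.Re (\sum_i F i) = \sum_i complex.Re (F i).
Proof. by elim/big_rec2: _ => // i y x _ <-; case: (F i); case: x. Qed.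

Lemma complexIm_sum (I : finType) (F : I -> R[i]) :
  complex.Im (\sum_i F i) = \sum_i complex.Im (F i).
Proof. by elim/big_rec2: _ => // i y x _ <-; case: (F i); case: x. Qed.

Lemma hurwitz_unit d (A : 'M[R]_d) : hurwitz A -> A \in unitmx.
Proof.
move=> hA; rewrite -row_free_unit; apply: inj_row_free => v vA0.
apply/eqP/negPn/negP => v0.
have : eigenvalue (map_mx (fun x => (x%:C)%C) A) (0 : R[i]).
  apply/eigenvalueP; exists (map_mx (real_complex R) v).
    by rewrite -map_mxM vA0 map_mx0 scale0r.
  by rewrite map_mx_eq0.
by move/hA; rewrite raddf0 ltxx.
Qed.

(** Schur triangularization gives a complex [S] with [J *m S = S *m T], where [T] is lower
    triangular with diagonal in the open left half-plane. Then [sqn (x *m B)] is a weighted sum of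
    the squared moduli of the entries of [x *m S]; placing real and imaginary parts side by side
    keeps [B] real, at the price of [d + d] columns. To first order this norm decreases at rate
    [2 * a * g], and half of that absorbs the term in [g ^+ 2]. *)
Lemma hurwitz_lyapunov d (J : 'M[R]_d) : hurwitz J^T ->
  exists (B : 'M[R]_(d, d + d)) (a g0 C : R),
    [/\ 0 < a, 0 < g0, 0 < C, forall x, sqn x <= C * sqn (x *m B) &
      forall g x, 0 <= g -> g <= g0 ->
        sqn ((x + g *: (x *m J)) *m B) <= (1 - a * g) * sqn (x *m B)].
Proof.
(* Schur's theorem is applied in positive dimension; in dimension 0 all squared norms vanish. *)
case: d J => [J _|d' J].
  by exists 0, 1, 1, 1; split => // [x|g x _ _]; rewrite /sqn !big_ord0// !mulr0.
set d := d'.+1 => hJ.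
pose Jc : 'M[R[i]]_d := map_mx (real_complex R) J.
have [P Pu Ptrig] := Schur Jc (ltn0Sn d').
have Punit : P \in unitmx by exact: unitarymx_unit.
pose S := invmx P; pose T := P *m Jc *m S.
have JS : Jc *m S = S *m T by rewrite /T /S !mulmxA mulVmx// mul1mx.
have TE : conjmx P Jc = T by rewrite conjumx.
have Ttrig : is_trig_mx T by rewrite -TE.
(* The diagonal of [T] consists of eigenvalues of [T], hence of [Jc] by similarity, hence of its
   transpose, which has the same characteristic polynomial. *)
have Tdiag i : complex.Re (T i i) < 0.
  have : eigenvalue T (T i i).
    rewrite eigenvalue_root_char char_poly_trig//.
    by rewrite /root horner_prod (bigD1 i)//= !hornerE subrr mul0r.
  rewrite -TE => /(eigenvalue_conjmx _ _) h.
  have {}h : eigenvalue Jc (conjmx P Jc i i).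
    apply: h; last by rewrite row_free_unit.
    by rewrite submx_full// row_full_unit.
  have {}h : eigenvalue (map_mx (fun x => (x%:C)%C) J^T) (conjmx P Jc i i).
    move: h; rewrite !eigenvalue_root_char.
    have -> : map_mx (fun x => (x%:C)%C) J^T = Jc^T by rewrite map_trmx.
    have -> // : char_poly Jc^T = char_poly Jc.
    rewrite /char_poly -[RHS]det_tr; congr (\det _).
    by rewrite /char_poly_mx linearB/= tr_scalar_mx [in RHS]map_trmx.
  by have := hJ _ h; rewrite -complexRe ltcR.
have SP : S *m P = 1%:M by rewrite mulVmx.
clearbody T S.
pose S1 := map_mx (@complex.Re R) S; pose S2 := map_mx (@complex.Im R) S.
pose T1 := map_mx (@complex.Re R) T; pose T2 := map_mx (@complex.Im R) T.
have JS1 : J *m S1 = S1 *m T1 - S2 *m T2.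
  apply/matrixP => i j; move/matrixP/(_ i j): JS => /(congr1 (@complex.Re R)).
  rewrite !mxE !complexRe_sum -sumrB => e.
  transitivity (\sum_k complex.Re (Jc i k * S k j)).
    by apply: eq_bigr => k _; rewrite !mxE; case: (S k j) => p q /=; ring.
  rewrite {}e; apply: eq_bigr => k _; rewrite !mxE.
  by case: (S i k) => ? ?; case: (T k j) => ? ? /=; ring.
have JS2 : J *m S2 = S1 *m T2 + S2 *m T1.
  apply/matrixP => i j; move/matrixP/(_ i j): JS => /(congr1 (@complex.Im R)).
  rewrite !mxE !complexIm_sum -big_split/= => e.
  transitivity (\sum_k complex.Im (Jc i k * S k j)).
    by apply: eq_bigr => k _; rewrite !mxE; case: (S k j) => p q /=; ring.
  rewrite {}e; apply: eq_bigr => k _; rewrite !mxE.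
  by case: (S i k) => ? ?; case: (T k j) => ? ? /=; ring.
have [a a0 ha] : exists2 a, 0 < a & forall i, T1 i i <= - (2 * a).
  pose b := \big[Num.max/-1]_i T1 i i.
  have b0 : b < 0.
    by apply/bigmax_ltP; split => [|i _]; rewrite ?ltrN10// mxE Tdiag.
  exists (- b / 2); first by rewrite divr_gt0// oppr_gt0.
  move=> i; have -> : - (2 * (- b / 2)) = b by field.
  exact: (@le_bigmax _ _ _ (-1) (fun i => T1 i i) i).
have [w w0 hw] : exists2 w : 'I_d -> R, (forall i, 0 < w i) &
  forall u v : 'rV[R]_d,
    \sum_j w j ^+ 2 * (u 0 j * (u *m T1 - v *m T2) 0 j + v 0 j * (u *m T2 + v *m T1) 0 j)
    <= - a * \sum_j w j ^+ 2 * (u 0 j ^+ 2 + v 0 j ^+ 2).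
  apply: triangular_dissipative => // i j ij; rewrite mxE;
    by move/is_trig_mxP: Ttrig => ->.
pose W := diag_mx (\row_j w j).
pose B : 'M[R]_(d, d + d) := row_mx (S1 *m W) (S2 *m W).
have BlE (x : 'rV[R]_d) j : (x *m B) 0 (lshift d j) = w j * (x *m S1) 0 j.
  by rewrite mul_mx_row row_mxEl mulmxA mul_mx_diag !mxE mulrC.
have BrE (x : 'rV[R]_d) j : (x *m B) 0 (rshift d j) = w j * (x *m S2) 0 j.
  by rewrite mul_mx_row row_mxEr mulmxA mul_mx_diag !mxE mulrC.
have sqnB (x : 'rV[R]_d) :
    sqn (x *m B) = \sum_j w j ^+ 2 * ((x *m S1) 0 j ^+ 2 + (x *m S2) 0 j ^+ 2).
  rewrite /sqn big_split_ord/= -big_split/=; apply: eq_bigr => j _.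
  by rewrite BlE BrE; ring.
have dotB (x : 'rV[R]_d) : dotp (x *m B) (x *m J *m B) <= - a * sqn (x *m B).
  rewrite sqnB; apply: le_trans (hw _ _); apply: le_of_eq.
  rewrite dotpE big_split_ord/= -big_split/=; apply: eq_bigr => j _.
  rewrite !BlE !BrE -!(mulmxA x) JS1 JS2 mulmxBr mulmxDr !mulmxA; ring.
(* If both real blocks vanish at [x], the complex vector [x *m S] is zero, and [S] is invertible. A
   right inverse of [B] then bounds [sqn x] by the new norm. *)
have Bfree : row_free B.
  apply: inj_row_free => x xB0.
  have h1 : x *m S1 = 0.
    apply/rowP => j; have := BlE x j; rewrite xB0 !mxE => /esym/eqP.
    by rewrite mulf_eq0 gt_eqF//= => /eqP.
  have h2 : x *m S2 = 0.
    apply/rowP => j; have := BrE x j; rewrite xB0 !mxE => /esym/eqP.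
    by rewrite mulf_eq0 gt_eqF//= => /eqP.
  have : map_mx (real_complex R) x *m S = 0.
    apply/rowP => j; apply/eqP; rewrite eq_complex; apply/andP; split; apply/eqP.
      move/rowP/(_ j): h1; rewrite !mxE complexRe_sum => e; rewrite -[RHS]e.
      by apply: eq_bigr => k _; rewrite !mxE; case: (S k j) => ? ? /=; ring.
    move/rowP/(_ j): h2; rewrite !mxE complexIm_sum => e; rewrite -[RHS]e.
    by apply: eq_bigr => k _; rewrite !mxE; case: (S k j) => ? ? /=; ring.
  move/(congr1 (mulmx^~ P)); rewrite mul0mx -mulmxA SP mulmx1.
  by move/eqP; rewrite map_mx_eq0 => /eqP.
have [C C0 hC] := sqn_mulmx (pinvmx B).
have [C1 C10 hC1] := sqn_mulmx (J *m B).
have hCB (x : 'rV[R]_d) : sqn x <= C * sqn (x *m B).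
  by rewrite -[in leLHS](mulmxKp Bfree x).
(* Below this threshold [g ^+ 2 * sqn (x *m J *m B)] is at most [a * g * sqn (x *m B)]. *)
exists B, a, (a / (C1 * C)), C; split => //.
  by rewrite divr_gt0// mulr_gt0.
move=> g x g0; rewrite ler_pdivlMr ?mulr_gt0// => gle.
rewrite mulmxDl -scalemxAl sqnD dotpZr sqnZ.
have h1 := dotB x.
have h2 : sqn (x *m J *m B) <= C1 * C * sqn (x *m B).
  rewrite -mulmxA; apply: le_trans (hC1 x) _; rewrite -mulrA ler_wpM2l ?(ltW C10)//.
have h3 := ler_wpM2l g0 h1.
have h4 := ler_wpM2l (sqr_ge0 g) h2.
have h5 := ler_wpM2r (mulr_ge0 g0 (sqn_ge0 (x *m B))) gle.
lra.
Qed.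

End HurwitzLyapunov.

(** * Taylor expansion and step sizes *)

Section Taylor.
Variable R : realType.

Lemma is_derive_line n m (h : 'rV[R]_n -> 'rV[R]_m) (a v : 'rV[R]_n) (s : R) i :
  differentiable h (a + s *: v) ->
  is_derive s 1 (fun s : R => h (a + s *: v) 0 i) ((v *m jacobian h (a + s *: v)) 0 i).
Proof.
move=> dh; set x := a + s *: v.
have D : (fun k : R => k^-1 *: (h (k *: v + x) - h x)) @ 0^' --> v *m jacobian h x.
  rewrite -(deriveEjacobian v dh); exact: (diff_derivable dh).
have E : (fun k : R => k^-1 *: (((fun s : R => h (a + s *: v) 0 i) \o shift s) (k *: 1)
     - h (a + s *: v) 0 i)) = (fun k : R => (k^-1 *: (h (k *: v + x) - h x)) 0 i).
  apply/funext => k; rewrite !mxE /= /shift/=.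
  have -> : a + (k *: 1 + s) *: v = k *: v + x; last by [].
  by rewrite /x scalerDl [k *: 1]mulr1 addrCA.
have {}D : (fun k : R => (k^-1 *: (h (k *: v + x) - h x)) 0 i) @ 0^' --> (v *m jacobian h x) 0 i.
  have C : {for v *m jacobian h x, continuous (fun M : 'rV[R]_m => M 0 i)}.
    exact: coord_continuous.
  exact: cvg_comp D C.
split; first by rewrite /derivable E; apply/cvg_ex; exists ((v *m jacobian h x) 0 i).
by rewrite /derive E; apply: cvg_lim; first exact: Rhausdorff.
Qed.

Lemma mulmx_norm_le n m (v : 'rV[R]_n) (M : 'M[R]_(n, m)) i :
  `|(v *m M) 0 i| <= n%:R * (`|v| * `|M|).
Proof.
rewrite mxE; apply: le_trans (ler_norm_sum _ _ _) _.
apply: (@le_trans _ _ (\sum_(k < n) `|v| * `|M|)).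
  apply: ler_sum => k _; rewrite normrM ler_pM ?coord_norm_le//.
  by rewrite [leRHS]/Num.norm/= mx_normrE; apply: (@le_bigmax _ _ _ _ _ (k, i)).
by rewrite sumr_const card_ord mulr_natl.
Qed.

Lemma differentiable_lipschitz_at (V W : normedModType R) (f : V -> W) x :
  differentiable f x -> exists2 K, 0 < K &
    \forall y \near x, `|f y - f x| <= K * `|y - x|.
Proof.
move=> df; have [k k0 hk] := linear_lipschitz (diff_continuous df).
exists (k + 1); first by rewrite addr_gt0.
have := diff_locally df => /eqaddoP /(_ 1 ltr01).
move=> H.
have {}H : \forall z \near (0 : V), `|f (z + x) - (f x + 'd f x z)| <= `|z|.
  by apply: filterS H => z; rewrite mul1r.
have {}H : \forall y \near x, `|f y - (f x + 'd f x (y - x))| <= `|y - x|.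
  have c : (fun y => y - x) @ x --> (0 : V).
    rewrite -(subrr x); apply: cvgB; [exact: cvg_id|exact: cvg_cst].
  have H1 : \forall y \near x, `|f (y - x + x) - (f x + 'd f x (y - x))| <= `|y - x|.
    exact: c _ H.
  by apply: filterS H1 => y; rewrite subrK.
apply: filterS H => y hy.
have -> : f y - f x = (f y - (f x + 'd f x (y - x))) + 'd f x (y - x).
  by rewrite opprD addrA subrK.
apply: le_trans (ler_normD _ _) _; rewrite mulrDl mul1r addrC lerD//; exact: hk.
Qed.

(** The Jacobian, being differentiable at [x], satisfies a Lipschitz bound there; the mean value
    theorem on the segment from [x] to [y], one coordinate at a time, turns this bound into a
    quadratic remainder. *)
Lemma C2_taylor d (h : 'rV[R]_d -> 'rV[R]_d) (x : 'rV[R]_d) :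
  (exists V, nbhs x V /\ C2_on V h) ->
  exists2 C, 0 < C & \forall y \near x,
    sqn (h y - h x - (y - x) *m jacobian h x) <= C * sqn (y - x) ^+ 2.
Proof.
move=> [V [nV [dh [dJ _]]]].
have [K K0 hK] := differentiable_lipschitz_at (dJ _ (nbhs_singleton nV)).
have [e /= e0 he] : exists2 e : R, 0 < e & forall y, `|y - x| < e ->
    differentiable h y /\ `|jacobian h y - jacobian h x| <= K * `|y - x|.
  have : \forall y \near x, differentiable h y /\ `|jacobian h y - jacobian h x| <= K * `|y - x|.
    by near=> y; split; [apply: dh|]; near: y.
  move=> /nbhs_normP[e e0 he]; exists e => // y yx; apply: he.
  by rewrite /ball_/= distrC.
exists (d%:R * (d%:R * K) ^+ 2 + 1); first by rewrite ltr_wpDl// mulr_ge0 ?sqr_ge0.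
apply/nbhs_normP; exists e => // y; rewrite /ball_/= distrC => yx.
set v := y - x in yx *.
have xv : x + v = y by rewrite addrC subrK.
have line s : 0 <= s <= 1 -> `|x + s *: v - x| <= `|v|.
  move=> /andP[s0 s1]; rewrite addrC addKr normrZ ger0_norm//.
  by rewrite ler_piMl.
have comp i : `|(h y - h x - v *m jacobian h x) 0 i| <= d%:R * K * `|v| ^+ 2.
  have dl s : 0 <= s <= 1 -> differentiable h (x + s *: v).
    by move=> s01; have [] := he (x + s *: v) (le_lt_trans (line _ s01) yx).
  have [|||c] := @MVT R (fun s => h (x + s *: v) 0 i)
     (fun s => (v *m jacobian h (x + s *: v)) 0 i) 0 1.
  - exact: ltr01.
  - move=> s; rewrite in_itv/= => /andP[s0 s1]; apply: is_derive_line; apply: dl.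
    by rewrite !ltW.
  - apply: derivable_within_continuous => s; rewrite in_itv/= => s01.
    by have [] := is_derive_line i (dl _ s01).
  rewrite in_itv/= => /andP[c0 c1]; have c01 : 0 <= c <= 1 by rewrite !ltW.
  rewrite scale1r scale0r addr0 subr0 mulr1 xv => E.
  have -> : (h y - h x - v *m jacobian h x) 0 i =
     (v *m (jacobian h (x + c *: v) - jacobian h x)) 0 i.
    by rewrite mulmxBr [RHS]mxE -E !mxE.
  apply: le_trans (mulmx_norm_le _ _ _) _; rewrite -mulrA ler_wpM2l//.
  rewrite expr2 mulrCA ler_wpM2l//.
  have [_ h1] := he (x + c *: v) (le_lt_trans (line _ c01) yx).
  by apply: le_trans h1 _; rewrite ler_wpM2l ?(ltW K0)// line.
apply: (@le_trans _ _ (\sum_(i < d) (d%:R * K * `|v| ^+ 2) ^+ 2)).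
  apply: ler_sum => i _; rewrite -real_normK ?num_real//.
  by rewrite ler_sqr ?nnegrE ?comp// mulr_ge0 ?sqr_ge0// mulr_ge0// ltW.
rewrite sumr_const card_ord -[leLHS]mulr_natl exprMn mulrA.
apply: (@le_trans _ _ (d%:R * (d%:R * K) ^+ 2 * sqn v ^+ 2)).
  rewrite ler_wpM2l//; first by rewrite mulr_ge0 ?sqr_ge0.
  by rewrite ler_sqr ?nnegrE ?sqr_ge0 ?sqn_ge0// norm_sqn_le.
by rewrite ler_wpM2r ?sqr_ge0// lerDl.
Unshelve. all: by end_near.
Qed.

End Taylor.

(** * Consequences of the step-size conditions *)

Section StepSizes.
Variable R : realType.

(** The finitely many early ratios [f i / b i] are added to the constant. The conclusion starts at
    index 1, as the step sizes do. *)
Lemma eventually_dominated (f b : nat -> R) N M :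
  (forall n, (0 < n)%N -> 0 < b n) ->
  (forall n, (N <= n)%N -> f n <= M * b n) ->
  exists2 M', 0 < M' & forall n, (0 < n)%N -> f n <= M' * b n.
Proof.
move=> b0 hM; pose S := \sum_(i < N) `|f i / b i|.
have S0 : 0 <= S by apply: sumr_ge0.
exists (1 + `|M| + S); first by rewrite -addrA ltr_pwDl// addr_ge0.
move=> n n0; have bn := b0 n n0; case: (leqP N n) => nN.
  apply: le_trans (hM n nN) _; rewrite ler_wpM2r ?(ltW bn)//.
  by have := ler_norm M; lra.
have h : `|f n / b n| <= S.
  by rewrite /S (bigD1 (Ordinal nN))//= lerDl sumr_ge0.
rewrite -ler_pdivrMr//; apply: le_trans (ler_norm _) _.
by apply: le_trans h _; have := normr_ge0 M; lra.
Qed.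

Lemma inv_sqrt_cvg0 : (fun n => (Num.sqrt n%:R)^-1) @ \oo --> (0 : R).
Proof.
apply/cvgr0Pnorm_lt => e e0.
have [N _ hN] := (cvgryPgt _).1 (@cvgr_idn R) (e^-1 ^+ 2).
exists N => // n /= nN; have := hN n nN => /= h.
have n0 : 0 < n%:R :> R by apply: le_lt_trans h; exact: sqr_ge0.
rewrite ger0_norm ?invr_ge0 ?sqrtr_ge0// invf_plt ?posrE ?sqrtr_gt0//.
by rewrite -(ger0_norm (ltW (etrans (invr_gt0 e) e0))) -sqrtr_sqr ltr_sqrt.
Qed.

Variable g : nat -> R.
Hypothesis g_gt0 : forall n, (0 < n)%N -> 0 < g n.

Lemma summable_sqr_small :
  cvg ((fun n => \sum_(1 <= k < n.+1) g k ^+ 2) @ \oo) ->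
  forall e, 0 < e -> \forall n \near \oo, g n < e.
Proof.
move=> cv e e0; set S := (fun n => _) in cv.
have c0 : (fun n => S n.+1 - S n) @ \oo --> (0 : R).
  rewrite -(subrr (lim (S @ \oo))); apply: cvgB => //.
  by rewrite -(cvg_shiftS S) in cv *.
have e2 : 0 < e ^+ 2 by rewrite exprn_gt0.
have [N _ hN] := cvgr0_norm_lt _ c0 _ e2.
exists N.+1 => // -[//|n]/= nN; have := hN n nN.
rewrite /S/= big_nat_recr//=. rewrite addrAC subrr add0r ger0_norm ?sqr_ge0//.
by rewrite ltr_pXn2r// ?nnegrE ltW// g_gt0.
Qed.

Hypothesis g_small : forall e, 0 < e -> \forall n \near \oo, g n < e.
Hypothesis g_log : (fun k => ln (g k.-1 / g k) / g k) @ \oo --> (0 : R).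

(** The logarithmic condition in multiplicative form: [1 + x <= exp x], at [ln r] and at [- ln r],
    bounds the ratio [r] from both sides. The steps vary slowly enough for a bound by a multiple of
    [g n] to be carried to the next index. *)
Lemma step_ratio c : 0 < c ->
  \forall n \near \oo, `|g n / g n.+1 - 1| <= c * g n.+1.
Proof.
(* Half of [c], because the upper bound comes as [r - 1 <= b * g n.+1 * r] with [r <= 2]; the
   minimum with 1 is what gives [r <= 2]. *)
move=> c0; pose b := Num.min c 1 / 2.
have m0 : 0 < Num.min c 1 by rewrite lt_min c0 ltr01.
have b0 : 0 < b by rewrite divr_gt0.
have bc : 2 * b <= c by rewrite /b mulrC divfK// ge_min lexx.
have b1 : 2 * b <= 1 by rewrite /b mulrC divfK// ge_min lexx orbT.
have [N _ hN] := cvgr0_norm_lt _ g_log _ b0.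
have [N' _ hN'] := g_small ltr01.
exists (maxn N N').+1 => // n /= nN.
have n0 : (0 < n)%N by apply: leq_ltn_trans nN.
have /= := hN n.+1 _; have /= := hN' n.+1 _.
rewrite /= in nN *; have nN1 : (N <= n.+1)%N by move: nN; rewrite -ltnS; lia.
have nN2 : (N' <= n.+1)%N by lia.
move=> /(_ nN2) g1 /(_ nN1).
have gn := g_gt0 n0; have gS := g_gt0 (ltn0Sn n).
set r := g n / g n.+1; have r0 : 0 < r by rewrite divr_gt0.
rewrite normrM normfV (gtr0_norm gS) ltr_pdivrMr// ltr_norml => /andP[l1 l2].
have x1 : b * g n.+1 <= 1 / 2.
  by have := ler_pM (ltW b0) (ltW gS) (lexx b) (ltW g1); lra.
have lo := expR_ge1Dx (ln r); rewrite (lnK r0) in lo.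
have hi := expR_ge1Dx (- ln r); rewrite expRN (lnK r0) in hi.
have hi2 : (1 - b * g n.+1) * r <= 1.
  rewrite -ler_pdivlMr// mul1r; apply: le_trans hi; lra.
have g2 : 2 * b * g n.+1 <= c * g n.+1 by rewrite ler_wpM2r// ltW.
have bg : 0 < b * g n.+1 by rewrite mulr_gt0.
rewrite ler_norml; apply/andP; split; first by lra.
have r2 : r <= 2.
  have : (1 - 1 / 2) * r <= (1 - b * g n.+1) * r by rewrite ler_wpM2r ?(ltW r0)//; lra.
  lra.
have := ler_wpM2l (ltW bg) r2; lra.
Qed.

(** Forcing of order [g ^+ 2] against contraction of order [g] balances at order [g]. Replacing
    [g n] by [g n.+1] loses a relative [a / 2 * g n.+1], which leaves half of the contraction to
    absorb [C]. *)
Lemma step_recursion_bound (c : nat -> R) a C N : 0 < a ->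
  (forall n, (N <= n)%N -> 0 <= c n) ->
  (forall n, (N <= n)%N -> c n.+1 <= (1 - a * g n.+1) * c n + C * g n.+1 ^+ 2) ->
  exists2 K, 0 < K & forall n, (0 < n)%N -> c n <= K * g n.
Proof.
move=> a0 cN cS.
have [N1 _ hN1] := step_ratio (divr_gt0 a0 (ltr0n R 2)).
have [N2 _ hN2] := g_small (divr_gt0 ltr01 a0).
pose n0 := (maxn N (maxn N1 N2)).+1.
(* The first entry closes the induction step, since it gives [C <= K * a / 2]; the second starts the
   induction at [n0]. *)
pose K := Num.max (2 * `|C| / a) (c n0 / g n0).
apply: (@eventually_dominated c g n0 K) => // n; elim: n => [|n IH] nn0; first by [].
case: (ltngtP n0 n.+1) nn0 => // [nn|e] _; last first.
  rewrite -e -ler_pdivrMr ?g_gt0// /K le_max lexx orbT//.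
have {}IH := IH nn.
have n_gt0 : (0 < n)%N by move: nn; rewrite /n0; lia.
have nN : (N <= n)%N by move: nn; rewrite /n0; lia.
have nN1 : (N1 <= n)%N by move: nn; rewrite /n0; lia.
have nN2 : (N2 <= n.+1)%N by move: nn; rewrite /n0; lia.
have := hN1 n nN1; have := hN2 n.+1 nN2; rewrite /= ltr_pdivlMr// mulrC => ag.
have gn := g_gt0 n_gt0; have gS := g_gt0 (ltn0Sn n).
rewrite ler_norml => /andP[_]; rewrite lerBlDr ler_pdivrMr// => gle.
have KC : `|C| <= K * a / 2.
  have : 2 * `|C| / a <= K by rewrite /K le_max lexx.
  by rewrite ler_pdivrMr// => ?; lra.
have K0 : 0 <= K.
  by apply: (@le_trans _ _ (2 * `|C| / a)); [rewrite divr_ge0 ?mulr_ge0// ltW|rewrite /K le_max lexx].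
apply: le_trans (cS n nN) _.
have ag1 : 0 <= 1 - a * g n.+1 by lra.
have h1 := ler_wpM2l ag1 IH.
have h2 := ler_wpM2l (mulr_ge0 ag1 K0) gle.
have h3 : C * g n.+1 ^+ 2 <= K * a / 2 * g n.+1 ^+ 2.
  by rewrite ler_wpM2r ?sqr_ge0//; apply: le_trans (ler_norm _) KC.
have h4 : 0 <= K * a ^+ 2 / 2 * g n.+1 ^+ 3.
  by rewrite !mulr_ge0 ?exprn_ge0// ltW.
lra.
Qed.

Lemma inv_sqrt_step_cvg0 : (fun n => n%:R * g n) @ \oo --> +oo ->
  (fun n => (Num.sqrt n%:R)^-1 * (Num.sqrt (g n.+1))^-1) @ \oo --> (0 : R).
Proof.
move=> ng; apply/cvgr0Pnorm_lt => e e0.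
have [N _ hN] := (cvgryPgt _).1 ng (2 / e ^+ 2).
exists N.+1 => // n /= nN.
have n0 : (0 < n)%N by lia.
have := hN n.+1 (leqW (ltnW nN)) => /= h.
have gS := g_gt0 (ltn0Sn n).
rewrite -invfM -sqrtrM// ger0_norm ?invr_ge0 ?sqrtr_ge0//.
have ng0 : 0 < n%:R * g n.+1 by rewrite mulr_gt0// ltr0n.
rewrite invf_plt ?posrE ?sqrtr_gt0//.
have -> : e^-1 = Num.sqrt (e^-1 ^+ 2) by rewrite sqrtr_sqr ger0_norm ?invr_ge0 ?ltW.
rewrite ltr_sqrt// exprVn.
have n1 : n.+1%:R <= 2 * n%:R :> R by rewrite -natrM ler_nat; lia.
have := ler_wpM2r (ltW gS) n1; lra.
Qed.

End StepSizes.

(** * Measurability and conditional expectation *)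

Section BorelVectors.
Context {R : realType} {dT : measure_display} {T : measurableType dT}.

(** Measurability by coordinates, to which the scalar lemmas apply; the conversions below identify
    it with the Borel form [meas_wrt measurable] of the hypotheses. *)
Definition vmeasurable n (X : T -> 'rV[R]_n) :=
  forall i, measurable_fun setT (fun w => X w 0 i).

Lemma meas_wrt_measurable_fun (X : T -> R) :
  meas_wrt measurable X -> measurable_fun setT X.
Proof.
move=> mX; apply: (measurability _ (RGenOpens.measurableE R)).
move=> _ [_ [x [y ->]] <-]; rewrite setTI; apply: mX.
by apply: sub_gen_smallest; exact: interval_open.
Qed.

Lemma meas_wrt_vmeasurable n (X : T -> 'rV[R]_n) :
  meas_wrt measurable X -> vmeasurable X.
Proof.
move=> mX i; apply: meas_wrt_measurable_fun => B.
suff : borel_of B -> borel_of ((fun x : 'rV[R]_n => x 0 i) @^-1` B).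
  by move=> h /h; exact: mX.
have sA : sigma_algebra setT (@borel_of 'rV[R]_n) by exact: smallest_sigma_algebra.
case: sA => s0 sC sU.
apply: (@smallest_sub _ _ _ [set B | borel_of ((fun x : 'rV[R]_n => x 0 i) @^-1` B)]).
  split => /=; first by rewrite preimage_set0.
    by move=> A hA; rewrite setTD preimage_setC -setTD; exact: sC.
  by move=> A hA; rewrite preimage_bigcup; exact: sU.
move=> O oO /=; apply: sub_gen_smallest => /=.
by apply: open_comp => // x _; exact: coord_continuous.
Qed.

(** An open set is the union of the rational boxes [B p] that it contains, of which there are
    countably many, and the preimage of a box is a finite intersection of coordinate conditions. *)
Lemma vmeasurable_meas_wrt n (X : T -> 'rV[R]_n) :
  vmeasurable X -> meas_wrt measurable X.
Proof.
move=> mX.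
apply: (@smallest_sub _ _ _ [set B | measurable (X @^-1` B)]).
  split => /=; first by rewrite preimage_set0.
    by move=> A hA; rewrite setTD preimage_setC; exact: measurableC.
  by move=> A hA; rewrite preimage_bigcup; exact: bigcupT_measurable.
move=> O oO /=.
pose B (p : 'rV[rat]_n * nat) := [set y : 'rV[R]_n |
  forall i, `|y 0 i - ratr (p.1 0 i)| < p.2.+1%:R^-1].
have -> : X @^-1` O = \bigcup_p (if `[< B p `<=` O >] then X @^-1` B p else set0).
  apply/seteqP; split => [w /= Ow|w [p _]]; last first.
    by case: asboolP => // BO /BO.
  have /nbhs_normP[e /= e0 he] := open_nbhs_nbhs (conj oO Ow).
  have [k hk] : exists k : nat, k.+1%:R^-1 < e / 2.
    have /cvgr0Pnorm_lt/(_ _ (divr_gt0 e0 (ltr0n R 2)))[k _ /(_ k)] := @cvg_harmonic R.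
    by move=> /(_ (leqnn k)); rewrite /= ger0_norm//; exists k.
  have q i : {q : rat | `|X w 0 i - ratr q| < k.+1%:R^-1}.
    apply: cid; have : X w 0 i - k.+1%:R^-1 < X w 0 i + k.+1%:R^-1.
      by rewrite ltrD2l gtrN// invr_gt0.
    move=> /rat_in_itvoo[q]; rewrite in_itv/= => /andP[q1 q2]; exists q.
    rewrite ltr_norml; move: q1 q2; move: (ratr q : R) (k.+1%:R^-1 : R) => a b q1 q2.
    by apply/andP; split; lra.
  pose p : 'rV[rat]_n * nat := (\row_i sval (q i), k).
  have Bw : B p (X w) by move=> i; rewrite /= mxE; exact: (svalP (q i)).
  exists p => //; case: asboolP => // nBO; exfalso; apply: nBO => y By; apply: he.
  rewrite /ball_/= [ltLHS]/Num.norm/= mx_normrE; apply/bigmax_ltP; split => // -[a i] _.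
  rewrite ord1 !mxE/=; have := By i; have := Bw i; rewrite /= => h1 h2.
  have -> : X w 0 i - y 0 i = (X w 0 i - ratr (p.1 0 i)) - (y 0 i - ratr (p.1 0 i)) by ring.
  apply: le_lt_trans (ler_normB _ _) (lt_trans (ltrD h1 h2) _).
  by move: hk; move: (k.+1%:R^-1 : R) => b hk; lra.
apply: countable_bigcupT_measurable => // p; case: asboolP => // _.
have -> : X @^-1` B p = \bigcap_(i in [set: 'I_n])
    ((fun w => `|X w 0 i - ratr (p.1 0 i)|) @^-1` `]-oo, p.2.+1%:R^-1[).
  apply/seteqP; split => w /=; first by move=> h i _ /=; rewrite in_itv/=; exact: h.
  by move=> h i; have := h i Logic.I; rewrite /= in_itv.
apply: fin_bigcap_measurable => // i _.
rewrite -[X in measurable X]setTI.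
suff : measurable_fun setT (fun w => `|X w 0 i - ratr (p.1 0 i)|) by apply.
apply: measurableT_comp => //.
by apply: measurable_funB => //; exact: mX.
Qed.

Lemma vmeasurableD n (X Y : T -> 'rV[R]_n) :
  vmeasurable X -> vmeasurable Y -> vmeasurable (fun w => X w + Y w).
Proof.
move=> mX mY i; under eq_fun do rewrite mxE.
by apply: measurable_funD; [exact: mX|exact: mY].
Qed.

Lemma vmeasurableZ n (c : T -> R) (X : T -> 'rV[R]_n) :
  measurable_fun setT c -> vmeasurable X -> vmeasurable (fun w => c w *: X w).
Proof.
move=> mc mX i; under eq_fun do rewrite mxE.
by apply: measurable_funM => //; exact: mX.
Qed.

Lemma vmeasurable_sum n (I : Type) (s : seq I) (X : I -> T -> 'rV[R]_n) :
  (forall i, vmeasurable (X i)) -> vmeasurable (fun w => \sum_(i <- s) X i w).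
Proof.
move=> mX i; under eq_fun do rewrite summxE.
by apply: measurable_sum => j; exact: mX.
Qed.

Lemma vmeasurable_mulmx n p (X : T -> 'rV[R]_n) (M : 'M[R]_(n, p)) :
  vmeasurable X -> vmeasurable (fun w => X w *m M).
Proof.
move=> mX i; under eq_fun do rewrite mxE.
by apply: measurable_sum => j; apply: measurable_funM => //; exact: mX.
Qed.

Lemma vmeasurable_cst n (x : 'rV[R]_n) : vmeasurable (fun _ => x).
Proof. by move=> i; exact: measurable_cst. Qed.

Lemma measurable_sqn n (X : T -> 'rV[R]_n) :
  vmeasurable X -> measurable_fun setT (fun w => sqn (X w)).
Proof.
by move=> mX; apply: measurable_sum => i; apply: measurable_funX; exact: mX.
Qed.

Lemma measurable_dotp n (t : 'rV[R]_n) (X : T -> 'rV[R]_n) :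
  vmeasurable X -> measurable_fun setT (fun w => dotp t (X w)).
Proof.
move=> mX; under eq_fun do rewrite dotpE.
by apply: measurable_sum => i; apply: measurable_funM => //; exact: mX.
Qed.

(** [h] is measurable only for the trace on [D]; as [X] stays in [D], a Borel set [C] with the same
    trace replaces the preimage of [B] under [h]. *)
Lemma meas_on_dom_comp n (D : set 'rV[R]_n) (h : 'rV[R]_n -> 'rV[R]_n)
  (X : T -> 'rV[R]_n) :
  meas_on_dom D h -> (forall w, D (X w)) -> vmeasurable X ->
  vmeasurable (fun w => h (X w)).
Proof.
move=> mh DX /vmeasurable_meas_wrt mX; apply: meas_wrt_vmeasurable => B /mh[C [bC DC]].
have -> : (fun w => h (X w)) @^-1` B = X @^-1` C; last exact: mX.
apply/seteqP; split => w /= hw.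
  by have [] : (D `&` C) (X w) by rewrite -DC; split => //; exact: DX.
by have [] : (D `&` h @^-1` B) (X w) by rewrite DC; split => //; exact: DX.
Qed.

Lemma measurable_cvg_set n (X : nat -> T -> 'rV[R]_n) (x : 'rV[R]_n) :
  (forall q, vmeasurable (X q)) ->
  measurable [set w | (fun q => X q w) @ \oo --> x].
Proof.
move=> mX.
have -> : [set w | (fun q => X q w) @ \oo --> x] =
  \bigcap_k \bigcup_N \bigcap_(q in [set q | (N <= q)%N])
    ((fun w => sqn (X q w - x)) @^-1` `]-oo, k.+1%:R^-1[).
  apply/seteqP; split => w /=.
    move=> /cvgrPdist_lt h k _.
    pose e : R := (k.+1%:R * n.+1%:R)^-1.
    have e0 : 0 < e by rewrite invr_gt0.
    have e1 : e <= 1 by rewrite invf_le1// -natrM ler1n.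
    have [N _ hN] := h e e0; exists N => // q /= Nq; rewrite in_itv/=.
    have := hN q Nq; rewrite /= distrC => hq.
    apply: le_lt_trans (sqn_le_norm _) _.
    apply: (@le_lt_trans _ _ (n%:R * e)).
      rewrite ler_wpM2l// expr2 -[leRHS]mulr1 ler_pM//; first exact: ltW.
      by apply: ltW; exact: lt_le_trans hq e1.
    rewrite /e invfM mulrCA -ltr_pdivlMl ?invr_gt0// invrK mulfV//.
    by rewrite ltr_pdivrMr// mul1r ltr_nat.
  move=> h; apply/cvgrPdist_lt => e e0.
  have e2 : 0 < e ^+ 2 by rewrite exprn_gt0.
  have /cvgr0Pnorm_lt/(_ _ e2)[k _ /(_ k)] := @cvg_harmonic R.
  move=> /(_ (leqnn k)); rewrite /= ger0_norm// => ke.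
  have [N _ hN] := h k Logic.I; exists N => // q Nq /=.
  have := hN q Nq; rewrite /= in_itv/= => hq.
  rewrite distrC -(@ltr_pXn2r _ 2)// ?nnegrE ?(ltW e0)//.
  by apply: le_lt_trans (norm_sqn_le _) (lt_trans hq ke).
apply: bigcapT_measurable => k; apply: bigcupT_measurable => N.
apply: bigcap_measurableType => q _.
rewrite -[X in measurable X]setTI.
suff : measurable_fun setT (fun w => sqn (X q w - x)) by apply.
apply: measurable_sqn; apply: vmeasurableD => //; exact: vmeasurable_cst.
Qed.

End BorelVectors.

(** * Products with a conditionally centred variable *)

Section ConditionalExpectation.
Context {dT : measure_display} {T : measurableType dT} {R : realType}.
Variables (P : probability T R) (G : set (set T)).
Hypotheses (sG : sigma_algebra setT G) (Gm : G `<=` measurable).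

Import HBNNSimple.

Let TG := g_sigma_algebraType G.

Lemma sub_sigma_measurable_fun (X : T -> R) :
  measurable_fun setT (X : TG -> R) -> measurable_fun setT X.
Proof.
move=> mX _ B mB; rewrite setTI; apply: Gm.
rewrite -(measurable_g_measurableTypeE sG).
by have := mX measurableT B mB; rewrite setTI.
Qed.

Variable e : T -> R.
Hypothesis ie : P.-integrable setT (EFin \o e).
Hypothesis e0 : forall B, G B -> (\int[P]_(w in B) (e w)%:E = 0)%E.

Let integrable_indicM (A : set T) : measurable A ->
  P.-integrable setT (fun w => ((\1_A w : R)%:E * (e w)%:E)%E).
Proof.
move=> mA; have -> : (fun w => ((\1_A w : R)%:E * (e w)%:E)%E) = (EFin \o e) \_ A.
  apply/funext => w; rewrite patchE indicE.
  by case: (w \in A); rewrite ?mul1e ?mul0e.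
apply: ((integrable_mkcond _ mA).1 _).
exact: (integrableS measurableT mA (@subsetT _ _) ie).
Qed.

Let integral_indicM (A : set T) : G A ->
  (\int[P]_w ((\1_A w : R)%:E * (e w)%:E) = 0)%E.
Proof.
move=> mA; have -> : (fun w => ((\1_A w : R)%:E * (e w)%:E)%E) = (EFin \o e) \_ A.
  apply/funext => w; rewrite patchE indicE.
  by case: (w \in A); rewrite ?mul1e ?mul0e.
by rewrite -integral_mkcond; exact: e0.
Qed.

Lemma integral_nnsfunM_eq0 (g : {nnsfun TG >-> R}) :
  (\int[P]_w (g w * e w)%:E = 0)%E.
Proof.
pose s := finmap.enum_fset (fset_set (range g)).
have Gg r : G (g @^-1` [set r]).
  have GE (B : set TG) : measurable B -> G B.
    by move=> mB; rewrite -(measurable_g_measurableTypeE sG).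
  by apply: GE; exact: measurable_funPTI.
have -> : (fun w : T => (g w * e w)%:E) = (fun w => \sum_(y <- s)
    (y%:E * ((\1_(g @^-1` [set y]) w : R)%:E * (e w)%:E)))%E.
  apply/funext => w; rewrite (fimfunE g w) fsbig_finite//= mulr_suml -sumEFin.
  by apply: eq_bigr => i _; rewrite -mulrA !EFinM.
rewrite integral_sum//.
  apply: big1 => i _; rewrite integralZl//; last exact/integrable_indicM/Gm.
  by rewrite integral_indicM// mule0.
by move=> i; apply: integrableZl => //; exact/integrable_indicM/Gm.
Qed.

Let integral_ge0M_eq0 (X : T -> R) : measurable_fun setT (X : TG -> R) ->
  (forall w, 0 <= X w) ->
  P.-integrable setT (fun w => (X w * e w)%:E) ->
  (\int[P]_w (X w * e w)%:E = 0)%E.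
Proof.
move=> mX X0 iXe.
have mXE : measurable_fun setT ((EFin \o X) : TG -> \bar R) by exact/measurable_EFinP.
pose g n : {nnsfun TG >-> R} := nnsfun_approx measurableT mXE n.
have X0' : forall x : TG, setT x -> (0 <= (EFin \o X) x)%E by move=> x _; rewrite lee_fin.
have gX w : EFin \o (fun n => g n w) @ \oo --> (X w)%:E.
  exact: (@cvg_nnsfun_approx _ _ _ _ measurableT _ mXE X0' w).
have gle n w : g n w <= X w.
  have := le_approx n X0' (Logic.I : setT w).
  by rewrite /g nnsfun_approxE lee_fin.
have g0 n w : 0 <= g n w by exact: fun_ge0.
have me : measurable_fun setT e by exact/measurable_EFinP/(measurable_int _ ie).
have mXT : measurable_fun setT X by exact: sub_sigma_measurable_fun.
have [| | | | |_ _ h] := @dominated_convergence _ T R P setT measurableT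
  (fun n w => (g n w * e w)%:E) (fun w => (X w * e w)%:E) (fun w => `|(X w * e w)%:E|%E).
- move=> n; apply/measurable_EFinP; apply: measurable_funM => //.
  by apply: sub_sigma_measurable_fun; exact: measurable_funPT.
- by apply/measurable_EFinP; apply: measurable_funM.
- apply: aeW => w _; under eq_fun do rewrite EFinM.
  by rewrite EFinM; apply: cvgeZr => //; exact: gX.
- by apply: integrable_abse.
- apply: aeW => w n _; rewrite /= lee_fin !normrM ler_wpM2r//.
  by rewrite !ger0_norm.
have hz : (fun n => \int[P]_w (g n w * e w)%:E)%E = (fun=> 0%E).
  by apply/funext => n; rewrite integral_nnsfunM_eq0.
rewrite /= hz in h.
exact: (cvg_unique (@ereal_hausdorff R) h (cvg_cst 0%E)).
Qed.

(** The identity on the sets of [G] extends to simple functions, then to nonnegative [X] by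
    dominated convergence under [|X * e|], then to all [X] by positive and negative parts.
    Integrability of the product is what admits unbounded [X]. *)
Lemma integral_mul_cond0 (X : T -> R) : measurable_fun setT (X : TG -> R) ->
  P.-integrable setT (fun w => (X w * e w)%:E) ->
  (\int[P]_w (X w * e w)%:E = 0)%E.
Proof.
move=> mX iXe.
have mXT : measurable_fun setT X by exact: sub_sigma_measurable_fun.
have me : measurable_fun setT e by exact/measurable_EFinP/(measurable_int _ ie).
have mp : measurable_fun setT (X^\+ : TG -> R) by exact: measurable_funrpos.
have mn : measurable_fun setT (X^\- : TG -> R) by exact: measurable_funrneg.
have le_int (Y : T -> R) : measurable_fun setT (Y : TG -> R) ->
    (forall w, `|Y w| <= `|X w|) -> P.-integrable setT (fun w => (Y w * e w)%:E).
  move=> mY YX; apply: le_integrable iXe => //.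
    by apply/measurable_EFinP; apply: measurable_funM => //; exact: sub_sigma_measurable_fun.
  by move=> w _; rewrite /= lee_fin !normrM ler_wpM2r.
have pX w : `|X^\+ w| <= `|X w|.
  by rewrite ger0_norm ?funrpos_ge0// /funrpos ge_max ler_norm/=.
have nX w : `|X^\- w| <= `|X w|.
  by rewrite ger0_norm ?funrneg_ge0// /funrneg ge_max -normrN ler_norm/=.
have ip := le_int _ mp pX; have in_ := le_int _ mn nX.
have -> : (fun w => (X w * e w)%:E) =
    (fun w => (X^\+ w * e w)%:E - (X^\- w * e w)%:E)%E.
  apply/funext => w; rewrite -EFinB -mulrBl; congr (_ * _)%:E.
  by rewrite -[in LHS](funrposBneg X).
rewrite integralB// !integral_ge0M_eq0// ?subee//.

Qed.

End ConditionalExpectation.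

(** * Second moment of the linearized iteration *)

Section Moments.
Context {dT : measure_display} {T : measurableType dT} {R : realType}.
Variable P : probability T R.

(** The integral is extended-real and [c] is real, so the bound carries integrability with it. *)
Definition moment_le (f : T -> R) (c : R) :=
  [/\ measurable_fun setT f, forall w, 0 <= f w &
      (\int[P]_w (f w)%:E <= c%:E)%E].

Lemma moment_le_ge0 (f : T -> R) (c : R) : moment_le f c -> 0 <= c.
Proof.
move=> [_ f0 h]; rewrite -lee_fin; apply: le_trans h.
by apply: integral_ge0 => w _; rewrite lee_fin.
Qed.

Lemma moment_le_mono (f f' : T -> R) (c c' : R) : measurable_fun setT f' ->
  (forall w, 0 <= f' w <= f w) -> c <= c' -> moment_le f c -> moment_le f' c'.
Proof.
move=> mf' ff cc [mf f0 h]; split => //; first by move=> w; case/andP: (ff w).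
apply: (@le_trans _ _ c%:E); last by rewrite lee_fin.
apply: le_trans h; apply: ge0_le_integral => //.
- by move=> w _; rewrite lee_fin; case/andP: (ff w).
- exact/measurable_EFinP.
- exact/measurable_EFinP.
- by move=> w _; rewrite lee_fin; case/andP: (ff w).
Qed.

Lemma moment_leD (f f' : T -> R) (c c' : R) : moment_le f c -> moment_le f' c' ->
  moment_le (fun w => f w + f' w) (c + c').
Proof.
move=> [mf f0 h] [mf' f'0 h']; split; first exact: measurable_funD.
  by move=> w; rewrite addr_ge0.
under eq_integral do rewrite EFinD.
rewrite ge0_integralD//.
- by rewrite EFinD leeD.
- by move=> w _; rewrite lee_fin.
- exact/measurable_EFinP.
- by move=> w _; rewrite lee_fin.
- exact/measurable_EFinP.
Qed.

Lemma moment_leZ (k : R) (f : T -> R) (c : R) : 0 <= k -> moment_le f c ->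
  moment_le (fun w => k * f w) (k * c).
Proof.
move=> k0 [mf f0 h]; split; first exact: measurable_funM.
  by move=> w; rewrite mulr_ge0.
under eq_integral do rewrite EFinM.
rewrite ge0_integralZl_EFin//.
- by rewrite EFinM lee_wpmul2l// lee_fin.
- by move=> w _; rewrite lee_fin.
- exact/measurable_EFinP.
Qed.

Lemma moment_le_cst (k : R) : 0 <= k -> moment_le (fun=> k) k.
Proof.
move=> k0; split => //.
rewrite (_ : (\int[P]_w k%:E)%E = \int[P]_w cst k%:E w)%E// integral_cst//=.
by rewrite [X in (_ * X)%E]probability_setT mule1.
Qed.

Lemma moment_le_sum (I : Type) (s : seq I) (f : I -> T -> R) (c : I -> R) :
  (forall i, moment_le (f i) (c i)) ->
  moment_le (fun w => \sum_(i <- s) f i w) (\sum_(i <- s) c i).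
Proof.
move=> h; elim: s => [|i s IH].
  rewrite big_nil; under [f in moment_le f _]eq_fun do rewrite big_nil.
  exact: moment_le_cst.
rewrite big_cons; under [f in moment_le f _]eq_fun do rewrite big_cons.
exact: moment_leD.
Qed.

Lemma moment_le_integrable (f : T -> R) (c : R) : moment_le f c -> P.-integrable setT (EFin \o f).
Proof.
move=> [mf f0 h]; apply/integrableP; split; first exact/measurable_EFinP.
apply: le_lt_trans (ltry c); apply: le_trans h.
by under eq_integral do rewrite gee0_abs ?lee_fin//.
Qed.

Lemma integrable_coordM n (X Y : T -> 'rV[R]_n) a b i j :
  vmeasurable X -> vmeasurable Y ->
  moment_le (fun w => sqn (X w)) a -> moment_le (fun w => sqn (Y w)) b ->
  P.-integrable setT (fun w => (X w 0 i * Y w 0 j)%:E).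
Proof.
move=> mX mY hX hY.
apply: le_integrable (moment_le_integrable (moment_leD hX hY)) => //.
  by apply/measurable_EFinP; apply: measurable_funM; [exact: mX|exact: mY].
move=> w _; rewrite /= lee_fin [leRHS]ger0_norm ?addr_ge0 ?sqn_ge0//.
have h1 := sqn_coord (X w) i; have h2 := sqn_coord (Y w) j.
set x := X w 0 i in h1 *; set y := Y w 0 j in h2 *.
have hp : 0 <= (x + y) ^+ 2 by exact: sqr_ge0.
have hm : 0 <= (x - y) ^+ 2 by exact: sqr_ge0.
rewrite ler_norml; have := sqr_ge0 x; have := sqr_ge0 y => ? ?.
by apply/andP; split; lra.
Qed.

(** The cross term is a combination of the products [X w 0 i * Y w 0 j], with the entries of the
    Gram matrix [B *m B^T] as coefficients, so it integrates to zero. Hence [a] enters with factor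
    exactly 1, and a contraction of [X] is preserved; [a'] serves the integrability of the
    products. *)
Lemma moment_le_orthogonal n p (B : 'M[R]_(n, p)) (X Y : T -> 'rV[R]_n) a a' b C :
  (forall y : 'rV[R]_n, sqn (y *m B) <= C * sqn y) ->
  vmeasurable X -> vmeasurable Y ->
  moment_le (fun w => sqn (X w)) a' -> moment_le (fun w => sqn (X w *m B)) a ->
  moment_le (fun w => sqn (Y w)) b ->
  (forall i j, \int[P]_w (X w 0 i * Y w 0 j)%:E = 0)%E -> 0 <= C ->
  moment_le (fun w => sqn ((X w + Y w) *m B)) (a + C * b).
Proof.
move=> hC mX mY hX hXB hY orth C0.
split; [|by move=> w; exact: sqn_ge0|].
  by apply: measurable_sqn; apply: vmeasurable_mulmx; exact: vmeasurableD.
have hYB : moment_le (fun w => sqn (Y w *m B)) (C * b).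
  apply: moment_le_mono (moment_leZ C0 hY) => //.
    by apply: measurable_sqn; apply: vmeasurable_mulmx.
  by move=> w; rewrite sqn_ge0 hC.
pose G := B *m B^T.
have hS := moment_leD hXB hYB.
pose D w := \sum_i \sum_j (G i j * (X w 0 i * Y w 0 j)).
have iG i j : P.-integrable setT (fun w => ((G i j)%:E * (X w 0 i * Y w 0 j)%:E)%E).
  by apply: integrableZl => //; apply: integrable_coordM hX hY.
have DE : (fun w => (D w)%:E) = (fun w => \sum_i \sum_j (G i j)%:E * (X w 0 i * Y w 0 j)%:E)%E.
  apply/funext => w; rewrite /D -sumEFin; apply: eq_bigr => i _.
  by rewrite -sumEFin; apply: eq_bigr => j _; rewrite EFinM.
have iD : P.-integrable setT (fun w => (D w)%:E).
  rewrite DE; apply: integrable_sum => // i _; exact: integrable_sum.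
have ID : (\int[P]_w (D w)%:E = 0)%E.
  rewrite DE integral_sum//; last by move=> i; apply: integrable_sum.
  apply: big1 => i _; rewrite integral_sum//; apply: big1 => j _.
  by rewrite integralZl ?orth ?mule0//; apply: integrable_coordM hX hY.
have sE w : sqn ((X w + Y w) *m B) = (sqn (X w *m B) + sqn (Y w *m B)) + 2 * D w.
  rewrite mulmxDl sqnD; have -> : dotp (X w *m B) (Y w *m B) = D w; last by ring.
  rewrite /dotp trmx_mul mulmxA -(mulmxA _ B) -/G /D mxE.
  under eq_bigr do rewrite mxE [(Y w)^T _ _]mxE mulr_suml.
  rewrite exchange_big/=; apply: eq_bigr => i _; apply: eq_bigr => j _.
  by rewrite mulrAC mulrC.
under eq_integral do rewrite sE EFinD EFinM.
rewrite integralD//; last 2 first.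
- exact: moment_le_integrable hS.
- exact: integrableZl.
rewrite integralZl// ID mule0 adde0; by case: hS.
Qed.

End Moments.

(** * The linear recursion driven by truncated noise *)

Section LinearizedIteration.
Context {dT : measure_display} {T : measurableType dT} {R : realType}.
Variables (P : probability T R) (d : nat).

(** The indicator is taken one index earlier: it is then known from the past of [e n], and the
    product stays centred given that past. *)
Definition trunc_noise (Ak : nat -> set T) (e : nat -> T -> 'rV[R]_d) n w :=
  (\1_(Ak n.-1) w : R) *: e n w.

Fixpoint lin_iter (J : 'M[R]_d) (g : nat -> R) (e : nat -> T -> 'rV[R]_d) n w :=
  if n is n'.+1 then
    lin_iter J g e n' w + g n *: (lin_iter J g e n' w *m J) + g n *: e n w
  else 0.

Lemma measurable_fun_sub_sigma (G G' : set (set T)) (X : T -> R) :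
  G `<=` G' ->
  measurable_fun setT (X : g_sigma_algebraType G -> R) ->
  measurable_fun setT (X : g_sigma_algebraType G' -> R).
Proof.
move=> GG mX _ B mB; have := mX measurableT B mB.
by apply: sub_smallest2r => //; exact: smallest_sigma_algebra.
Qed.

Variables (F : nat -> set (set T)) (e : nat -> T -> 'rV[R]_d) (Ak : nat -> set T).
Hypotheses (hF : filtration F) (he : forall n, (0 < n)%N -> meas_wrt (F n) (e n)).
Hypotheses (he0 : cond_mean_zero P F e) (hA : forall k, F k (Ak k)).
Hypothesis hM : exists M : R, forall k, (0 < k)%N ->
  (\int[P]_w ((enorm (e k w)) ^+ 2 * (\1_(Ak k.-1) w : R))%:E <= M%:E)%E.

Let fs n : sigma_algebra setT (F n). Proof. by case: hF. Qed.
Let fm n : F n `<=` measurable. Proof. by case: hF => _ []. Qed.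
Let fi n : F n `<=` F n.+1. Proof. by case: hF => _ []. Qed.

Let indicF n : measurable_fun setT (\1_(Ak n) : g_sigma_algebraType (F n) -> R).
Proof. by apply: measurable_indic; apply: sub_gen_smallest; exact: hA. Qed.

Let eF n : (0 < n)%N -> @vmeasurable R _ (g_sigma_algebraType (F n)) d (e n).
Proof.
move=> n0; apply: meas_wrt_vmeasurable => B /(he n0) h.
exact: sub_gen_smallest.
Qed.

Let truncF n : (0 < n)%N ->
  @vmeasurable R _ (g_sigma_algebraType (F n)) d (trunc_noise Ak e n).
Proof.
case: n => // n _; apply: (@vmeasurableZ R _ (g_sigma_algebraType (F n.+1))); last exact: eF.
by apply: (@measurable_fun_sub_sigma (F n) (F n.+1) (\1_(Ak n))); [exact: fi|exact: indicF].
Qed.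

Lemma vmeasurable_trunc n : (0 < n)%N -> vmeasurable (trunc_noise Ak e n).
Proof.
by move=> n0 i; apply: (sub_sigma_measurable_fun (fs n) (@fm n)); exact: truncF.
Qed.

Lemma trunc_noise_moment : exists M : R, forall n, (0 < n)%N ->
  moment_le P (fun w => sqn (trunc_noise Ak e n w)) M.
Proof.
case: hM => M h; exists M => n n0; split.
- exact/measurable_sqn/vmeasurable_trunc.
- by move=> w; exact: sqn_ge0.
apply: le_trans (h n n0); rewrite le_eqVlt; apply/orP; left; apply/eqP.
apply: eq_integral => w _; rewrite /trunc_noise sqnZ enorm_sqr mulrC indicE.
by case: (w \in _); rewrite ?expr1n ?expr0n.
Qed.

Variables (J : 'M[R]_d) (g : nat -> R).
Let mu := lin_iter J g (trunc_noise Ak e).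

Let muF n : @vmeasurable R _ (g_sigma_algebraType (F n)) d (mu n).
Proof.
elim: n => [|n IH]; first exact: vmeasurable_cst.
have {}IH : @vmeasurable R _ (g_sigma_algebraType (F n.+1)) d (mu n).
  by move=> i; apply: (@measurable_fun_sub_sigma (F n)); [exact: fi|exact: IH].
apply: (@vmeasurableD R _ (g_sigma_algebraType (F n.+1))).
  apply: (@vmeasurableD R _ (g_sigma_algebraType (F n.+1))) => //.
  apply: (@vmeasurableZ R _ (g_sigma_algebraType (F n.+1)) d (fun=> g n.+1)) => //.
  exact: (@vmeasurable_mulmx R _ (g_sigma_algebraType (F n.+1))).
by apply: (@vmeasurableZ R _ (g_sigma_algebraType (F n.+1)) d (fun=> g n.+1)) => //; exact: truncF.
Qed.

Lemma vmeasurable_lin_iter n : vmeasurable (mu n).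
Proof.
by move=> i; apply: (sub_sigma_measurable_fun (fs n) (@fm n)); exact: muF.
Qed.

(** The indicator of [Ak n] joins the factor [X w 0 i], which leaves [e n.+1] against an
    [F n]-measurable function; the two second moments make the product integrable. *)
Lemma trunc_noise_orthogonal n (X : T -> 'rV[R]_d) a i j :
  @vmeasurable R _ (g_sigma_algebraType (F n)) d X ->
  moment_le P (fun w => sqn (X w)) a ->
  (\int[P]_w (X w 0 i * trunc_noise Ak e n.+1 w 0 j)%:E = 0)%E.
Proof.
move=> mX hX; have [M hMM] := trunc_noise_moment.
have E : (fun w => (X w 0 i * trunc_noise Ak e n.+1 w 0 j)%:E) =
    (fun w => (X w 0 i * (\1_(Ak n) w : R) * e n.+1 w 0 j)%:E).
  by apply/funext => w; rewrite !mxE/= mulrA.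
have [ie e0] := he0 (ltn0Sn n) j.
rewrite E; apply: (integral_mul_cond0 (fs n) (@fm n) ie) => //.
  by apply: measurable_funM; [exact: mX|exact: indicF].
rewrite -E; apply: (@integrable_coordM _ _ _ _ _ X (trunc_noise Ak e n.+1) a M) => //.
- by move=> k; apply: (sub_sigma_measurable_fun (fs n) (@fm n)); exact: mX.
- exact: vmeasurable_trunc.
- exact: hMM.
Qed.

Hypotheses (g_gt0 : forall n, (0 < n)%N -> 0 < g n)
  (g_small : forall e, 0 < e -> \forall n \near \oo, g n < e)
  (g_log : (fun k => ln (g k.-1 / g k) / g k) @ \oo --> (0 : R))
  (hJ : hurwitz J^T).

(** In the Lyapunov norm the second moment is contracted by [1 - a * g n.+1] once the steps are
    small, with an additive term of order [g n.+1 ^+ 2]: orthogonality removes the cross term, which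
    carries a single factor [g n.+1]. *)
Lemma lin_iter_second_moment : exists2 K : R, 0 < K & forall n, (0 < n)%N ->
  moment_le P (fun w => sqn (mu n w)) (K * g n).
Proof.
have [B [a [g0 [C [a0 g00 C0 hC hcontr]]]]] := hurwitz_lyapunov hJ.
have [M hMM] := trunc_noise_moment.
have [C1 C10 hC1] := sqn_mulmx B.
pose g1 := Num.min g0 (1 / a).
have g10 : 0 < g1 by rewrite lt_min g00 divr_gt0.
(* Early steps may be too large to contract; they receive some finite factor, so that the moments
   are bounded from index 0 on. *)
have kap n : {k : R | g n.+1 < g1 -> k = 1 - a * g n.+1 & 0 <= k /\ forall x : 'rV[R]_d,
    sqn ((x + g n.+1 *: (x *m J)) *m B) <= k * sqn (x *m B)}.
  case: (ltP (g n.+1) g1) => gle.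
    have /andP[l1 l2] : (g n.+1 < g0) && (g n.+1 < 1 / a) by rewrite -lt_min.
    exists (1 - a * g n.+1) => //; split.
      by move: l2; rewrite ltr_pdivlMr// subr_ge0 mulrC => /ltW.
    by move=> x; apply: hcontr; rewrite ltW ?g_gt0.
  have [k k0 hk] := sqn_mulmx ((1%:M + g n.+1 *: J) *m B).
  exists (k * C) => //; split; first by rewrite mulr_ge0// ltW.
  move=> x; rewrite -mulrA; apply: (@le_trans _ _ (k * sqn x)).
    have -> : x + g n.+1 *: (x *m J) = x *m (1%:M + g n.+1 *: J).
      by rewrite mulmxDr mulmx1 -scalemxAr.
    by rewrite -mulmxA.
  by rewrite ler_wpM2l ?(ltW k0).
pose c := fix c n := if n is n'.+1 then
  s2val (kap n') * c n' + C1 * (g n ^+ 2 * M) else 0.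
have mmu n : vmeasurable (fun w => mu n w + g n.+1 *: (mu n w *m J)).
  apply: vmeasurableD; first exact: vmeasurable_lin_iter.
  apply: (@vmeasurableZ R _ T d (fun=> g n.+1)) => //.
  by apply: vmeasurable_mulmx; exact: vmeasurable_lin_iter.
have mc n : moment_le P (fun w => sqn (mu n w *m B)) (c n).
  elim: n => [|n IH].
    apply: moment_le_mono (moment_le_cst P (lexx 0)) => //.
      by apply/measurable_sqn/vmeasurable_mulmx/vmeasurable_cst.
    by move=> w; rewrite mul0mx sqn0 lexx.
  have [k0 hk] := s2valP' (kap n); set k := s2val _ in k0 hk.
  have hX : moment_le P (fun w => sqn ((mu n w + g n.+1 *: (mu n w *m J)) *m B)) (k * c n).
    apply: moment_le_mono (moment_leZ k0 IH) => //.
      by apply/measurable_sqn/vmeasurable_mulmx.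
    by move=> w; rewrite sqn_ge0 hk.
  have hX' : moment_le P (fun w => sqn (mu n w + g n.+1 *: (mu n w *m J))) (C * (k * c n)).
    apply: moment_le_mono (moment_leZ (ltW C0) hX) => //; first exact: measurable_sqn.
    by move=> w; rewrite sqn_ge0 hC.
  have hY : moment_le P (fun w => sqn (g n.+1 *: trunc_noise Ak e n.+1 w)) (g n.+1 ^+ 2 * M).
    apply: moment_le_mono (moment_leZ (sqr_ge0 (g n.+1)) (hMM n.+1 (ltn0Sn n))) => //.
      apply: measurable_sqn; apply: (@vmeasurableZ R _ T d (fun=> g n.+1)) => //.
      exact: vmeasurable_trunc.
    by move=> w; rewrite sqn_ge0 sqnZ lexx.
  apply: (moment_le_orthogonal hC1 (mmu n) _ hX' hX hY) => //; last exact: ltW.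
    apply: (@vmeasurableZ R _ T d (fun=> g n.+1)) => //.
    exact: vmeasurable_trunc.
  move=> i j.
  have E : (fun w => ((mu n w + g n.+1 *: (mu n w *m J)) 0 i *
       (g n.+1 *: trunc_noise Ak e n.+1 w) 0 j)%:E) =
     (fun w => ((g n.+1 *: (mu n w + g n.+1 *: (mu n w *m J))) 0 i *
       trunc_noise Ak e n.+1 w 0 j)%:E).
    by apply/funext => w; rewrite [in LHS](mxE _ _ 0 j) [in RHS]mxE mulrCA mulrA.
  rewrite E; apply: (@trunc_noise_orthogonal n
     (fun w => g n.+1 *: (mu n w + g n.+1 *: (mu n w *m J))) (g n.+1 ^+ 2 * (C * (k * c n)))).
    apply: (@vmeasurableZ R _ (g_sigma_algebraType (F n)) d (fun=> g n.+1)) => //.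
    apply: (@vmeasurableD R _ (g_sigma_algebraType (F n))) => //.
    apply: (@vmeasurableZ R _ (g_sigma_algebraType (F n)) d (fun=> g n.+1)) => //.
    exact: (@vmeasurable_mulmx R _ (g_sigma_algebraType (F n))).
  apply: moment_le_mono (moment_leZ (sqr_ge0 (g n.+1)) hX') => //.
    by apply: measurable_sqn; apply: (@vmeasurableZ R _ T d (fun=> g n.+1)).
  by move=> w; rewrite sqn_ge0 sqnZ lexx.
have [N _ hN] := g_small g10.
have [K K0 hK] : exists2 K, 0 < K & forall n, (0 < n)%N -> c n <= K * g n.
  apply: (step_recursion_bound (N := N) (C := C1 * M) g_gt0 g_small g_log a0).
    by move=> n _; exact: moment_le_ge0 (mc n).
  move=> n nN; rewrite /c -/c (s2valP (kap n)); last by apply: hN; rewrite /= leqW.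
  by rewrite lerD2l mulrCA mulrC mulrAC mulrA lexx.
exists (C * K); first exact: mulr_gt0.
move=> n n0; apply: moment_le_mono (moment_leZ (ltW C0) (mc n)).
- by apply: measurable_sqn; exact: vmeasurable_lin_iter.
- by move=> w; rewrite sqn_ge0 hC.
- by rewrite -mulrA ler_wpM2l ?(ltW C0)// hK.
Qed.

End LinearizedIteration.

(** * Rate of convergence *)

Lemma near_inftyS (A : nat -> Prop) :
  (\forall n \near \oo, A n) -> \forall n \near \oo, A n.+1.
Proof. by move=> [N _ h]; exists N => // n nN; apply: h; exact: leqW. Qed.

Section PathwiseBound.
Variables (R : realType) (d p : nat).
Variables (J : 'M[R]_d) (B : 'M[R]_(d, p)) (a C C1 : R).
Hypotheses (a0 : 0 < a) (C0 : 0 < C) (C10 : 0 < C1).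
Hypothesis hC : forall x : 'rV[R]_d, sqn x <= C * sqn (x *m B).
Hypothesis hC1 : forall x : 'rV[R]_d, sqn (x *m B) <= C1 * sqn x.

(** [sqnD_le] with weight [a * g / 2]. Half of the contraction is spent, as
    [1 - a * g <= (1 - a * g / 2) ^+ 2], and dividing [g ^+ 2] by the weight leaves one factor [g]
    on the perturbation. *)
Lemma lyapunov_step (g : R) (z w : 'rV[R]_d) : 0 < g -> a * g < 1 ->
  sqn ((z + g *: (z *m J)) *m B) <= (1 - a * g) * sqn (z *m B) ->
  sqn ((z + g *: (z *m J) + g *: w) *m B) <=
    (1 - a * g / 2) * sqn (z *m B) + 2 * g / a * (C1 * sqn w).
Proof.
move=> g0 ag1 hz.
have ag0 : 0 < a * g by rewrite mulr_gt0.
have s0 : 0 < a * g / 2 by rewrite divr_gt0.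
have s1 : a * g / 2 < 1 by lra.
rewrite mulmxDl; apply: le_trans (sqnD_le _ _ s0 s1) _; apply: lerD.
  rewrite ler_pdivrMr; last by lra.
  apply: le_trans hz _; rewrite mulrAC ler_wpM2r ?sqn_ge0//.
  have := sqr_ge0 (a * g); lra.
rewrite -scalemxAl sqnZ ler_pdivrMr//.
have -> : 2 * g / a * (C1 * sqn w) * (a * g / 2) = g ^+ 2 * (C1 * sqn w).
  by field; rewrite gt_eqF.
by rewrite ler_wpM2l ?sqr_ge0.
Qed.

Variables (g : nat -> R) (D hD mu e e' r r1 r2 : nat -> 'rV[R]_d).
Variables (chi1 chi2 chi xi : nat -> R) (M Cr : R).
Hypotheses (g_gt0 : forall n, (0 < n)%N -> 0 < g n)
  (g_small : forall e, 0 < e -> \forall n \near \oo, g n < e)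
  (g_log : (fun k => ln (g k.-1 / g k) / g k) @ \oo --> (0 : R)).
Hypothesis contr : \forall n \near \oo, forall x : 'rV[R]_d,
  sqn ((x + g n *: (x *m J)) *m B) <= (1 - a * g n) * sqn (x *m B).
Hypothesis Dstep : forall n,
  D n.+1 = D n + g n.+1 *: hD n + g n.+1 *: e n.+1 + g n.+1 *: r n.+1.
Hypothesis rE : forall n, (0 < n)%N -> r n = r1 n + r2 n.
Hypothesis mustep : forall n,
  mu n.+1 = mu n + g n.+1 *: (mu n *m J) + g n.+1 *: e' n.+1.
Hypothesis ee' : \forall n \near \oo, e n = e' n.
Hypothesis hrho : \forall n \near \oo, sqn (hD n - D n *m J) <= Cr * sqn (D n) ^+ 2.
Hypothesis D0 : forall e, 0 < e -> \forall n \near \oo, sqn (D n) < e.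
Hypotheses (M0 : 0 <= M) (Cr0 : 0 < Cr).
Let S n := \sum_(1 <= k < n.+1) r2 k.
Hypothesis hr1 : forall n, (0 < n)%N -> sqn (r1 n) <= M * g n * chi1 n.
Hypothesis hr2 : forall n, (0 < n)%N -> g n * sqn (S n) <= M * chi2 n.
Hypothesis chi1_ge0 : forall n, 0 <= chi1 n.
Hypothesis chi2_ge0 : forall n, 0 <= chi2 n.
Hypothesis chi_ge1 : forall n, 1 <= chi n.
Hypothesis hchi : forall n, (0 < n)%N ->
  chi1 n.+1 + chi2 n + sqn (mu n) / g n <= chi n.+1.
Hypothesis xi0 : 0 <= xi 0%N.
Hypothesis xistep : forall n,
  xi n.+1 = Num.max 0 (1 - a / 4 * g n.+1) * xi n + g n.+1 ^+ 2 * chi n.+1.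

Let xi_ge0 n : 0 <= xi n.
Proof.
elim: n => // n IH; rewrite xistep; apply: addr_ge0; apply: mulr_ge0 => //.
- by rewrite le_max lexx.
- exact: sqr_ge0.
- exact: le_trans ler01 (chi_ge1 _).
Qed.

(** The remainder [Z] follows a contracting recursion from which the noise has cancelled, since [e]
    and [e'] eventually agree. The comparison sequence [xi] has the same contraction and forcing
    [chi], but is built without [M], [Cr] and the starting time, so these end up in [M'] and [N]
    alone. *)
Lemma pathwise_rate_bound : exists M' : R, exists N : nat, forall n, (N <= n)%N ->
  sqn (D n) <= M' * (xi n + g n * chi n.+1).
Proof.
have [CJ CJ0 hCJ] := sqn_mulmx J.
(* Once [sqn (D n) < eps], the part of the quadratic remainder controlled by [Q n] costs at most
   [a * g n.+1 / 4 * Q n], half of the contraction left by [lyapunov_step]; hence the rate [a / 4]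
   in [xi]. *)
pose eps := a ^+ 2 / 4 / (16 * C1 * Cr * C).
have eps0 : 0 < eps by rewrite /eps !divr_gt0 ?exprn_gt0// !mulr_gt0.
(* Subtracting [g n *: S n] is a summation by parts: only the partial sums of
   [r2] are controlled. *)
pose Z n := D n - mu n - g n *: S n.
pose Q n := sqn (Z n *m B).
have Q0 n : 0 <= Q n by exact: sqn_ge0.
have muE n : (0 < n)%N -> sqn (mu n) <= g n * chi n.+1.
  move=> n0; have gn := g_gt0 n0; rewrite mulrC -ler_pdivrMr//.
  apply: le_trans (hchi n0); rewrite lerDr addr_ge0//.
have SE n : (0 < n)%N -> g n ^+ 2 * sqn (S n) <= M * (g n * chi n.+1).
  move=> n0; have gn := g_gt0 n0.
  have h : chi2 n <= chi n.+1.
    apply: le_trans (hchi n0); have := chi1_ge0 n.+1.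
    have : 0 <= sqn (mu n) / g n by rewrite divr_ge0 ?sqn_ge0// ltW.
    by move: (sqn (mu n) / g n) => x; lra.
  have h1 := ler_wpM2l (ltW gn) (hr2 n0).
  have h2 := ler_wpM2l (mulr_ge0 M0 (ltW gn)) h.
  lra.
have DE n : (0 < n)%N -> sqn (D n) <= 2 * C * Q n + 4 * (1 + M) * (g n * chi n.+1).
  move=> n0; have -> : D n = Z n + (mu n + g n *: S n).
    by rewrite /Z -[D n - _ - _]addrA -opprD subrK.
  apply: le_trans (sqnD_le2 _ _) _.
  have h1 := hC (Z n); have h2 := sqnD_le2 (mu n) (g n *: S n).
  rewrite sqnZ in h2; have h3 := muE n n0; have h4 := SE n n0.
  rewrite -/(Q n) in h1; lra.
(* The perturbation factor of [lyapunov_step], without its [g], times the coefficient of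
   [g n.+1 * chi n.+1] in the bound on [sqn w] below. *)
pose K := 2 * C1 / a * (4 * (Cr * eps * (8 * (1 + M)) + M + 2 * (CJ + 4) * M)).
have K0 : 0 <= K.
  have e0 := mulr_gt0 Cr0 eps0; rewrite /K.
  apply: mulr_ge0; first by rewrite divr_ge0 ?mulr_ge0// ltW.
  apply: mulr_ge0 => //; apply: addr_ge0.
    apply: addr_ge0 => //; apply: mulr_ge0; first exact: ltW.
    by rewrite mulr_ge0// addr_ge0.
  by rewrite mulr_ge0// mulr_ge0// addr_ge0// ltW.
have h2 : 0 < 2^-1 :> R by rewrite invr_gt0.
have [N0 _ hN0] := filterI (near_inftyS contr) (filterI (near_inftyS ee')
  (filterI hrho (filterI (D0 eps0) (filterI (step_ratio g_gt0 g_small g_log ltr01)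
  (filterI (near_inftyS (g_small (divr_gt0 ltr01 a0))) (near_inftyS (g_small h2))))))).
pose N := N0.+1.
have Qstep n : (N <= n)%N ->
    Q n.+1 <= Num.max 0 (1 - a / 4 * g n.+1) * Q n + K * (g n.+1 ^+ 2 * chi n.+1).
  move=> nN.
  have n0 : (0 < n)%N by apply: leq_ltn_trans nN.
  have [/= f1 [/= f2 [/= f3 [/= f4 [/= f5 [/= f6 f7]]]]]] := hN0 n (ltnW nN).
  have gn := g_gt0 n0; have gS := g_gt0 (ltn0Sn n).
  set G := g n.+1 in f1 f5 f6 f7 gS *.
  rewrite ltr_pdivlMr// mulrC in f6.
  rewrite mul1r in f5.
  have f5' := f5; rewrite ler_norml in f5'; case/andP: f5' => l1 l2.
  have l3 : g n <= 2 * G.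
    by rewrite -ler_pdivrMr//; lra.
  have l4 : G <= 2 * g n.
    have : 1 / 2 <= g n / G by lra.
    by rewrite ler_pdivlMr//; lra.
  pose u := hD n - D n *m J.
  pose q := (g n - G) / G.
  (* What the linear part leaves: [g n *: (S n *m J)] because [J] acts on [Z n] and not on
     [D n - mu n], and [q *: S n] because the subtracted partial sum has factor [g n] at one index
     and [g n.+1] at the next. By [step_ratio], [q] is of order [g n]. *)
  pose w := u + r1 n.+1 + (g n *: (S n *m J) + q *: S n).
  have SS : S n.+1 = S n + r2 n.+1 by rewrite /S big_nat_recr.
  have ZE : Z n.+1 = Z n + G *: (Z n *m J) + G *: w.
    rewrite /Z Dstep mustep -/G f2 rE// SS /w /u.
    have -> : hD n = (hD n - D n *m J) + D n *m J by rewrite subrK.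
    rewrite addrK !mulmxBl -scalemxAl.
    apply/rowP => j; rewrite !mxE /q.
    move: (D n 0 j) (mu n 0 j) (S n 0 j) => x1 x2 x3.
    move: (\sum_j0 _) (\sum_j0 _) (\sum_j0 _) => y1 y2 y3.
    by field; rewrite gt_eqF.
  have x0 : 0 <= G * chi n.+1 by rewrite mulr_ge0 ?(ltW gS)// (le_trans ler01).
  have gchi : g n * chi n.+1 <= 2 * (G * chi n.+1).
    by rewrite mulrA ler_wpM2r// (le_trans ler01).
  have wE : sqn w <= 8 * Cr * eps * C * Q n +
      4 * (Cr * eps * (8 * (1 + M)) + M + 2 * (CJ + 4) * M) * (G * chi n.+1).
    have w1 := sqnD_le2 (u + r1 n.+1) (g n *: (S n *m J) + q *: S n).
    have w2 := sqnD_le2 u (r1 n.+1).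
    have w3 := sqnD_le2 (g n *: (S n *m J)) (q *: S n).
    rewrite !sqnZ in w3.
    have w4 : sqn u <= Cr * eps * (2 * C * Q n + 8 * (1 + M) * (G * chi n.+1)).
      apply: le_trans f3 _; rewrite expr2 -mulrA ler_wpM2l ?(ltW Cr0)//.
      apply: ler_pM => //; [exact: sqn_ge0|exact: sqn_ge0|exact: ltW|].
      apply: le_trans (DE n n0) _; rewrite lerD2l.
      have := ler_wpM2l M0 gchi; lra.
    have w5 : sqn (r1 n.+1) <= M * (G * chi n.+1).
      apply: le_trans (hr1 (ltn0Sn n)) _; rewrite -mulrA ler_wpM2l// ler_wpM2l ?(ltW gS)//.
      apply: le_trans (hchi n0); have := chi2_ge0 n.
      have : 0 <= sqn (mu n) / g n by rewrite divr_ge0 ?sqn_ge0// ltW.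
      by move: (sqn (mu n) / g n) => x; lra.
    have w6 : g n ^+ 2 * sqn (S n *m J) + q ^+ 2 * sqn (S n) <=
        (CJ + 4) * (2 * M * (G * chi n.+1)).
      have q2 : q ^+ 2 <= 4 * g n ^+ 2.
        have -> : 4 * g n ^+ 2 = (2 * g n) ^+ 2 by ring.
        rewrite -[q ^+ 2]real_normK ?num_real// ler_sqr ?nnegrE ?mulr_ge0 ?(ltW gn)//.
        by rewrite /q mulrBl divff ?gt_eqF//; exact: le_trans f5 l4.
      have s0 := sqn_ge0 (S n).
      have k1 := ler_wpM2l (sqr_ge0 (g n)) (hCJ (S n)).
      have k2 := ler_wpM2r s0 q2.
      have k3 := SE n n0.
      have k4 := ler_wpM2l M0 gchi.
      have k5 : g n ^+ 2 * sqn (S n) <= 2 * M * (G * chi n.+1) by lra.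
      have k6 : 0 <= CJ + 4 by lra.
      have k7 := ler_wpM2l k6 k5.
      lra.
    rewrite -/w in w1; lra.
  have h := lyapunov_step w gS f6 (f1 (Z n)).
  rewrite -ZE -/(Q n) -/(Q n.+1) in h; apply: le_trans h _.
  have coef : 0 <= 2 * G / a * C1 by rewrite mulr_ge0 ?(ltW C10)// divr_ge0 ?mulr_ge0// ltW.
  have h3 := ler_wpM2l coef wE.
  rewrite mulrA; apply: le_trans (lerD (lexx _) h3) _.
  have epsE : 2 * G / a * C1 * (8 * Cr * eps * C * Q n) = a * G / 4 * Q n.
    by rewrite /eps; field; rewrite !gt_eqF.
  rewrite mulrDr epsE.
  have KE : 2 * G / a * C1 * (4 * (Cr * eps * (8 * (1 + M)) + M + 2 * (CJ + 4) * M) * (G * chi n.+1)) =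
     K * (G ^+ 2 * chi n.+1) by rewrite /K; ring.
  rewrite KE addrA lerD2r -mulrDl ler_wpM2r//.
  by rewrite le_max; apply/orP; right; lra.
(* [xi N > 0] for every [N > 0], so no matter when the recursion for [Q] starts to
   hold on a given path, its initial value is absorbed in a constant. *)
have xiN : 0 < xi N.
  rewrite /N xistep ltr_wpDl//; first by rewrite mulr_ge0// le_max lexx.
  by rewrite mulr_gt0 ?exprn_gt0 ?g_gt0//; exact: lt_le_trans ltr01 (chi_ge1 _).
pose M4 := Num.max K (Q N / xi N).
have M40 : 0 <= M4 by rewrite le_max K0.
have Qxi n : (N <= n)%N -> Q n <= M4 * xi n.
  elim: n => [|n IH] nN; first by move: nN; rewrite /N.
  case: (ltngtP N n.+1) nN => // [nn|<-] _; last first.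
    by rewrite -ler_pdivrMr// le_max lexx orbT.
  apply: le_trans (Qstep n nn) _; rewrite xistep mulrDr; apply: lerD.
    rewrite mulrCA ler_wpM2l//; first by rewrite le_max lexx.
    exact: IH.
  rewrite ler_wpM2r//; last by rewrite le_max lexx.
  by rewrite mulr_ge0 ?sqr_ge0// (le_trans ler01).
exists (2 * C * M4 + 4 * (1 + M)), N => n nN.
have n0 : (0 < n)%N by apply: leq_ltn_trans nN.
apply: le_trans (DE n n0) _.
have h1 : 0 <= 2 * C by rewrite mulr_ge0// ltW.
have h3 := ler_wpM2l h1 (Qxi n nN).
have gc : 0 <= g n * chi n.+1 by rewrite mulr_ge0 ?(ltW (g_gt0 n0))// (le_trans ler01).
have h4 := mulr_ge0 (mulr_ge0 h1 M40) gc.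
have h5 : 0 <= 4 * (1 + M) * xi n by rewrite !mulr_ge0 ?addr_ge0.
lra.
Qed.

End PathwiseBound.

(** * Error term of the averaged iteration *)

Section AveragingIdentity.
Variables (R : realType) (d : nat) (J : 'M[R]_d) (g : nat -> R).
Hypothesis g_gt0 : forall n, (0 < n)%N -> 0 < g n.

Section Path.
Variables D hD e r : nat -> 'rV[R]_d.
Hypothesis Dstep : forall n,
  D n.+1 = D n + g n.+1 *: hD n + g n.+1 *: e n.+1 + g n.+1 *: r n.+1.
Let rho k := hD k - D k *m J.
Let V n := (g n.+1)^-1 *: D n.+1 - (g 1)^-1 *: D 0
  - \sum_(1 <= k < n.+1) ((g k.+1)^-1 - (g k)^-1) *: D k.

Lemma abel_sum n :
  \sum_(k < n.+1) (D k *m J + (e k.+1 + r k.+1 + rho k)) = V n.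
Proof.
have incr k : D k *m J + (e k.+1 + r k.+1 + rho k) = (g k.+1)^-1 *: (D k.+1 - D k).
  have gk := g_gt0 (ltn0Sn k).
  rewrite Dstep /rho; apply/rowP => j; rewrite !mxE.
  by move: (\sum_j0 _) => y; field; rewrite gt_eqF.
elim: n => [|n IH].
  by rewrite big_ord_recl big_ord0 addr0 incr /V big_geq// subr0 scalerBr.
rewrite big_ord_recr/= {}IH incr /V [in RHS]big_nat_recr//=.
by apply/rowP => j; rewrite !mxE; ring.
Qed.

(** [abel_sum] solved for the sum of the [D k]. Vectors being rows, the inverse of [J] passes to [t]
    transposed, which makes it the inverse of the gradient when [J] is the Jacobian. *)
Lemma dotp_sum_errors (t : 'rV[R]_d) n : J \in unitmx ->
  dotp t (\sum_(k < n.+1) D k) = dotp (- (t *m invmx J^T))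
    (\sum_(k < n.+1) e k.+1 + \sum_(k < n.+1) r k.+1 + (\sum_(k < n.+1) rho k - V n)).
Proof.
move=> Ju; have := abel_sum n; rewrite big_split/= -mulmx_suml.
rewrite [X in _ + X = _]big_split/= [X in _ + (X + _) = _]big_split/= => E.
have -> : \sum_(k < n.+1) D k = - (\sum_(k < n.+1) e k.+1 + \sum_(k < n.+1) r k.+1 +
   (\sum_(k < n.+1) rho k - V n)) *m invmx J.
  set a := \sum_(k < n.+1) D k in E *; move: E.
  move: (\sum_(k < n.+1) e k.+1) (\sum_(k < n.+1) r k.+1) (\sum_(k < n.+1) rho k) => x y z E.
  by rewrite addrA -E opprB addrK mulmxK.
by rewrite dotp_mulmx -trmx_inv /dotp linearN/= mulmxN mulNmx.
Qed.
End Path.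

End AveragingIdentity.

(** * Error of the average along one path *)

Section PathError.
Variables (R : realType) (d : nat) (J : 'M[R]_d) (g : nat -> R).
Hypothesis g_gt0 : forall n, (0 < n)%N -> 0 < g n.

(** In order: the boundary term of the summation by parts, its increments, the quadratic remainders,
    the terms at index 0, and the change of normalisation of the noise from [sqrt n / n.+1] to
    [1 / sqrt n.+1]. It is affine in [eta] and [chie], so bounds on their expectations suffice. *)
Definition error_majorant (eta chie : nat -> R) n : R :=
  (Num.sqrt n%:R)^-1 *
  ((Num.sqrt (g n.+1))^-1 * eta n.+1
   + \sum_(1 <= k < n.+1) ((Num.sqrt (g k))^-1 * `|1 - g k / g k.+1|) * eta k
   + \sum_(1 <= k < n.+1) g k * eta k + 1
   + n.+1%:R^-1 * \sum_(k < n.+1) (1 + chie k.+1)).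

Variables D hT e r : nat -> 'rV[R]_d.
Hypothesis Dstep : forall n,
  D n.+1 = D n + g n.+1 *: hT n + g n.+1 *: e n.+1 + g n.+1 *: r n.+1.
Variables (eta chie : nat -> R) (M Mr Me : R).
Hypotheses (M0 : 0 <= M) (Mr0 : 0 <= Mr) (Me0 : 0 <= Me).
Hypotheses (eta1 : forall n, 1 <= eta n) (chie0 : forall n, 0 <= chie n).
Hypothesis hrho : forall k, (0 < k)%N -> `|hT k - D k *m J| <= Mr * (g k * eta k).
Hypothesis hD : forall k, (0 < k)%N -> sqn (D k) <= M * (g k * eta k).
Hypothesis he : forall k, (0 < k)%N -> `|e k| <= Me * (1 + chie k).

Lemma path_error_bound (t : 'rV[R]_d) : J \in unitmx ->
  let s := - (t *m invmx J^T) in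
  exists M', forall n, (0 < n)%N ->
   `|Num.sqrt n%:R * dotp t (n.+1%:R^-1 *: \sum_(k < n.+1) D k)
     - dotp s ((Num.sqrt n.+1%:R)^-1 *: \sum_(k < n.+1) e k.+1)
     - Num.sqrt n%:R / n.+1%:R * dotp s (\sum_(k < n.+1) r k.+1)|
   <= M' * error_majorant eta chie n.
Proof.
move=> Ju s; have [Cs Cs0 hCs] := dotp_le_norm s.
have eta0 k : 0 <= eta k by exact: le_trans ler01 (eta1 k).
(* The square root of [eta k] is replaced by [eta k], which is at least 1, to keep the majorant
   affine. *)
have hD' k : (0 < k)%N -> `|D k| <= (1 + M) * (Num.sqrt (g k) * eta k).
  move=> k0; have gk := g_gt0 k0.
  rewrite -(@ler_pXn2r _ 2)// ?nnegrE ?mulr_ge0 ?addr_ge0 ?sqrtr_ge0//.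
  apply: le_trans (norm_sqn_le _) (le_trans (hD k0) _).
  rewrite !exprMn sqr_sqrtr ?(ltW gk)//.
  have h1 : eta k <= eta k ^+ 2 by rewrite expr2 ler_peMl.
  have h2 : M <= (1 + M) ^+ 2 by have := sqr_ge0 M; have := M0; lra.
  by apply: ler_pM => //; [rewrite mulr_ge0// ltW|rewrite ler_wpM2l// ltW].
pose V n := (g n.+1)^-1 *: D n.+1 - (g 1)^-1 *: D 0%N
  - \sum_(1 <= k < n.+1) ((g k.+1)^-1 - (g k)^-1) *: D k.
pose X1 n := (Num.sqrt (g n.+1))^-1 * eta n.+1.
pose X2 n := \sum_(1 <= k < n.+1) ((Num.sqrt (g k))^-1 * `|1 - g k / g k.+1|) * eta k.
pose X3 n := \sum_(1 <= k < n.+1) g k * eta k.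
pose X5 n := n.+1%:R^-1 * \sum_(k < n.+1) (1 + chie k.+1).
have sg k : 0 <= (Num.sqrt (g k))^-1 by rewrite invr_ge0 sqrtr_ge0.
have X10 n : 0 <= X1 n by rewrite mulr_ge0.
have X20 n : 0 <= X2 n.
  by apply: sumr_ge0 => k _; rewrite !mulr_ge0.
have X30 n : 0 <= X3 n.
  by rewrite /X3 big_nat; apply: sumr_ge0 => k /andP[k0 _]; rewrite mulr_ge0// ltW// g_gt0.
have X50 n : 0 <= X5 n.
  by rewrite mulr_ge0 ?invr_ge0//; apply: sumr_ge0 => k _; rewrite addr_ge0.
pose rho k := hT k - D k *m J.
have rhoE n : `|\sum_(k < n.+1) rho k| <= `|rho 0%N| + Mr * X3 n.
  rewrite big_ord_recl; apply: le_trans (ler_normD _ _) _; rewrite lerD2l.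
  apply: le_trans (ler_norm_sum _ _ _) _; rewrite /X3 mulr_sumr big_add1/= big_mkord.
  by apply: ler_sum => k _; exact: hrho.
have VE n : `|V n| <= (1 + M) * X1 n + `|(g 1)^-1 *: D 0%N| + (1 + M) * X2 n.
  rewrite /V; apply: le_trans (ler_normB _ _) _; apply: lerD.
    apply: le_trans (ler_normB _ _) _; rewrite lerD2r.
    have gn := g_gt0 (ltn0Sn n); have sgn : 0 < Num.sqrt (g n.+1) by rewrite sqrtr_gt0.
    rewrite normrZ gtr0_norm ?invr_gt0// mulrC ler_pdivrMr//.
    apply: le_trans (hD' _ _) _ => //; rewrite /X1 -mulrA ler_wpM2l ?addr_ge0//.
    rewrite -[X in _ <= _ * X](sqr_sqrtr (ltW gn)) expr2 mulrACA mulVf ?gt_eqF// mul1r.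
    by rewrite mulrC.
  apply: le_trans (ler_norm_sum _ _ _) _; rewrite /X2 mulr_sumr !big_nat.
  apply: ler_sum => k /andP[k0 _]; have gk := g_gt0 k0; have gS := g_gt0 (ltn0Sn k).
  have sgk : 0 < Num.sqrt (g k) by rewrite sqrtr_gt0.
  rewrite normrZ; apply: le_trans (ler_wpM2l (normr_ge0 _) (hD' k k0)) _.
  apply: le_of_eq.
  have -> : (g k.+1)^-1 - (g k)^-1 = - ((g k)^-1 * (1 - g k / g k.+1)).
    by field; rewrite !gt_eqF.
  rewrite normrN normrM [`|(g k)^-1|]gtr0_norm ?invr_gt0//.
  have -> : (g k)^-1 = (Num.sqrt (g k))^-1 * (Num.sqrt (g k))^-1.
    by rewrite -invfM -expr2 sqr_sqrtr// ltW.
  by move: `|1 - _| => y; field; rewrite gt_eqF.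
have eE n : n.+1%:R^-1 * `|\sum_(k < n.+1) e k.+1| <= Me * X5 n.
  rewrite /X5 mulrCA ler_wpM2l ?invr_ge0//.
  apply: le_trans (ler_norm_sum _ _ _) _; rewrite mulr_sumr.
  by apply: ler_sum => k _; exact: he.
pose M4 := `|rho 0%N| + `|(g 1)^-1 *: D 0%N|.
have M40 : 0 <= M4 by rewrite addr_ge0.
pose Mt := Mr + (1 + M) + M4 + Me.
exists (Cs * Mt) => n n0.
set En := \sum_(k < n.+1) e k.+1; set Rn := \sum_(k < n.+1) r k.+1.
have nR : 0 < n%:R :> R by rewrite ltr0n.
have sn : 0 < Num.sqrt n%:R :> R by rewrite sqrtr_gt0.
have nS : 0 < n.+1%:R :> R by rewrite ltr0n.
have sS : 0 < Num.sqrt n.+1%:R :> R by rewrite sqrtr_gt0.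
have sn2 : Num.sqrt n%:R * Num.sqrt n%:R = n%:R :> R by rewrite -expr2 sqr_sqrtr// ltW.
have sS2 : Num.sqrt n.+1%:R * Num.sqrt n.+1%:R = n.+1%:R :> R.
  by rewrite -expr2 sqr_sqrtr// ltW.
set x := Num.sqrt n%:R in sn sn2 *; set y := Num.sqrt n.+1%:R in sS sS2 *.
have xy : x <= y by rewrite ler_wsqrtr// ler_nat.
have c1 : x / n.+1%:R <= x^-1.
  by rewrite ler_pdivrMr// ler_pdivlMl// sn2 ler_nat.
(* As [y * y = n.+1], the difference is [- (y - x) / n.+1], and
   [x * (y - x) <= y * y - x * x = 1]. *)
have c2 : `|x / n.+1%:R - y^-1| <= x^-1 * n.+1%:R^-1.
  have -> : x / n.+1%:R - y^-1 = - ((y - x) / n.+1%:R).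
    by rewrite -sS2; field; rewrite gt_eqF.
  rewrite normrN normrM [`|_^-1|]gtr0_norm ?invr_gt0// ler_wpM2r ?invr_ge0 ?(ltW nS)//.
  rewrite ger0_norm ?subr_ge0// -[leRHS]mulr1 ler_pdivlMl// mulrBr sn2.

  have yy : x * y <= y * y by rewrite ler_wpM2r// ltW.
  by rewrite sS2 -natr1 in yy; lra.
rewrite dotpZr (dotp_sum_errors g_gt0 Dstep _ _ Ju) -/s -/En -/Rn -/(V n).
have -> : x * (n.+1%:R^-1 * dotp s (En + Rn + (\sum_(k < n.+1) (hT k - D k *m J) - V n)))
    - dotp s (y^-1 *: En) - x / n.+1%:R * dotp s Rn =
    x / n.+1%:R * dotp s (\sum_(k < n.+1) rho k - V n) + (x / n.+1%:R - y^-1) * dotp s En.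
  by rewrite !dotpDr dotpZr; ring.
apply: le_trans (ler_normD _ _) _.
have b1 : `|x / n.+1%:R * dotp s (\sum_(k < n.+1) rho k - V n)| <=
    x^-1 * (Cs * (M4 + Mr * X3 n + (1 + M) * X1 n + (1 + M) * X2 n)).
  rewrite normrM; apply: ler_pM => //; first by rewrite ger0_norm ?divr_ge0 ?(ltW sn) ?(ltW nS).
  apply: le_trans (hCs _) _; rewrite ler_wpM2l ?(ltW Cs0)//.
  apply: le_trans (ler_normB _ _) _; have := rhoE n; have := VE n; rewrite /M4; lra.
have b2 : `|(x / n.+1%:R - y^-1) * dotp s En| <= x^-1 * (Cs * (Me * X5 n)).
  rewrite normrM.
  apply: le_trans (ler_pM (normr_ge0 _) (normr_ge0 _) c2 (hCs _)) _.
  rewrite -mulrA ler_wpM2l ?invr_ge0 ?(ltW sn)// mulrCA ler_wpM2l ?(ltW Cs0)//.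
apply: le_trans (lerD b1 b2) _.
rewrite /error_majorant -/x -/(X1 n) -/(X2 n) -/(X3 n) -/(X5 n) -mulrDr.
rewrite [leRHS]mulrCA ler_wpM2l ?invr_ge0 ?(ltW sn)// -mulrDr -mulrA ler_wpM2l ?(ltW Cs0)//.
have Mt0 : 0 <= 1 + M by rewrite addr_ge0.
have [m1 m2 m3] := And3 M0 Mr0 Me0.
have q1 (c u : R) : c <= Mt -> 0 <= u -> c * u <= Mt * u by move=> ? ?; rewrite ler_wpM2r.
have p1 : (1 + M) * X1 n <= Mt * X1 n by apply: q1 => //; rewrite /Mt; lra.
have p2 : (1 + M) * X2 n <= Mt * X2 n by apply: q1 => //; rewrite /Mt; lra.
have p3 : Mr * X3 n <= Mt * X3 n by apply: q1 => //; rewrite /Mt; lra.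
have p5 : Me * X5 n <= Mt * X5 n by apply: q1 => //; rewrite /Mt; lra.
have p4 : M4 <= Mt by rewrite /Mt; lra.
lra.
Qed.

End PathError.

(** * Rate and error of the random iteration on one localizing set *)

Section RateOfConvergence.
Context {dT : measure_display} {T : measurableType dT} {R : realType}.
Variables (P : probability T R) (d : nat) (F : nat -> set (set T)).
Variables (h : 'rV[R]_d -> 'rV[R]_d) (g : nat -> R).
Variables (e r r1 r2 : nat -> T -> 'rV[R]_d) (th0 ths : 'rV[R]_d).
Variables (A : set T) (Ak : nat -> set T).
Let theta := sa_iter h g e r th0.
Let L := [set w | (fun q => theta q w) @ \oo --> ths].
Let J := jacobian h ths.

Hypotheses (g_gt0 : forall n, (0 < n)%N -> 0 < g n)
  (g_small : forall e, 0 < e -> \forall n \near \oo, g n < e)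
  (g_log : (fun k => ln (g k.-1 / g k) / g k) @ \oo --> (0 : R)).
Hypotheses (h0 : h ths = 0) (hC2 : exists V, nbhs ths V /\ C2_on V h)
  (hJ : hurwitz (grad h ths)).
Hypotheses (hF : filtration F) (he : forall n, (0 < n)%N -> meas_wrt (F n) (e n)).
Hypotheses (he0 : cond_mean_zero P F e) (hA : forall k, F k (Ak k)).
Hypothesis hM : exists M : R, forall k, (0 < k)%N ->
  (\int[P]_w ((enorm (e k w)) ^+ 2 * (\1_(Ak k.-1) w : R))%:E <= M%:E)%E.
Hypothesis hAk : {ae P, forall w, L w ->
  (fun k => (\1_(Ak k) w : R)) @ \oo --> (\1_A w : R)}.
Hypothesis rE : forall n w, (0 < n)%N -> r n w = r1 n w + r2 n w.
Hypothesis hr1 : OwpOL2 P (fun n w =>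
  ((Num.sqrt (g n))^-1 * (\1_L w : R) * (\1_A w : R)) *: r1 n w).
Hypothesis hr2 : OwpOL2 P (fun n w =>
  (Num.sqrt (g n) * (\1_L w : R) * (\1_A w : R)) *: \sum_(1 <= k < n.+1) r2 k w).

Lemma remainder_small w : L w -> exists2 C, 0 < C &
  \forall n \near \oo, sqn (h (theta n w) - (theta n w - ths) *m J) <=
    C * sqn (theta n w - ths) ^+ 2.
Proof.
move=> Lw; have [C C0 hC] := C2_taylor hC2; exists C => //.
have H : \forall n \near \oo, sqn (h (theta n w) - h ths - (theta n w - ths) *m J) <=
  C * sqn (theta n w - ths) ^+ 2 by exact: Lw _ hC.
by apply: filterS H => n; rewrite h0 subr0.
Qed.

Lemma error_small w : L w ->
  forall eps, 0 < eps -> \forall n \near \oo, sqn (theta n w - ths) < eps.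
Proof.
move=> Lw eps eps0; pose b := Num.min 1 (eps / d.+1%:R).
have b0 : 0 < b by rewrite lt_min ltr01 divr_gt0.
have /cvgrPdist_lt/(_ _ b0) := Lw; apply: filterS => n /=.
rewrite distrC => hb; apply: le_lt_trans (sqn_le_norm _) _.
have b1 : b <= 1 by rewrite ge_min lexx.
have b2 : b <= eps / d.+1%:R by rewrite ge_min lexx orbT.
set x := `|_| in hb *; have x0 : 0 <= x by exact: normr_ge0.
have x2 : x ^+ 2 <= b.
  rewrite expr2 -[leRHS]mulr1 ler_pM//; first exact: ltW.
  by apply: ltW; exact: lt_le_trans hb b1.
apply: (@le_lt_trans _ _ (d%:R * (eps / d.+1%:R))).
  by rewrite ler_wpM2l// (le_trans x2).
by rewrite mulrCA -ltr_pdivlMl// mulVf ?gt_eqF// ltr_pdivrMr// mul1r ltr_nat.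
Qed.

(** An indicator at distance less than 1 from its limit 1 is equal to 1. *)
Lemma trunc_noise_eventually w :
  A w -> (fun k => (\1_(Ak k) w : R)) @ \oo --> (\1_A w : R) ->
  \forall n \near \oo, e n w = trunc_noise Ak e n w.
Proof.
move=> Aw /cvgrPdist_lt/(_ _ ltr01)[N _ hN]; exists N.+1 => // -[//|n] /= nN.
have := hN n nN; rewrite /trunc_noise /= !indicE mem_set//=.
by case: (w \in Ak n); rewrite ?scale1r// subr0 normr1 ltxx.
Qed.

(** The factors [Wb1], [Wb2] and the normalised [mu] enter [chi], which has bounded expectation; the
    almost surely bounded factors [W1], [W2] enter the constant of the path. On [L] and [A] both
    indicators are 1, so [r1] and the sums of [r2] are recovered from these factors. *)
Lemma averaging_rate : exists (eta : nat -> T -> R) (K : R),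
  [/\ forall n, moment_le P (eta n) K, forall n w, 1 <= eta n w &
    {ae P, forall w, L w -> A w -> exists M, forall n, (0 < n)%N ->
       sqn (theta n w - ths) <= M * (g n * eta n w)}].
Proof.
have [W1 [Wb1 [mW1 [eW1 [aeW1 [M1 hM1]]]]]] := hr1.
have [W2 [Wb2 [mW2 [eW2 [aeW2 [M2 hM2]]]]]] := hr2.
have mom1 n : (0 < n)%N -> moment_le P (fun w => sqn (Wb1 n w)) M1.
  move=> n0; split; first by apply/measurable_sqn/meas_wrt_vmeasurable; case: (mW1 n).
    by move=> w; exact: sqn_ge0.
  by have := hM1 n n0; under eq_integral do rewrite enorm_sqr.
have mom2 n : (0 < n)%N -> moment_le P (fun w => sqn (Wb2 n w)) M2.
  move=> n0; split; first by apply/measurable_sqn/meas_wrt_vmeasurable; case: (mW2 n).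
    by move=> w; exact: sqn_ge0.
  by have := hM2 n n0; under eq_integral do rewrite enorm_sqr.
pose mu := lin_iter J g (trunc_noise Ak e).
have [K1 K10 hmu] := @lin_iter_second_moment _ _ _ P d F e Ak hF he he0 hA hM J g
  g_gt0 g_small g_log hJ.
(* [Wb1], [Wb2] and [g] are unconstrained at index 0. *)
pose chi n w : R := if n is k.+2 then
  1 + sqn (Wb1 n w) + sqn (Wb2 k.+1 w) + (g k.+1)^-1 * sqn (mu k.+1 w) else 1.
have M10 := moment_le_ge0 (mom1 1%N isT); have M20 := moment_le_ge0 (mom2 1%N isT).
pose K2 := 1 + M1 + M2 + K1.
have mchi n : moment_le P (chi n) K2.
  have m1 : moment_le P (fun=> 1) K2.
    apply: moment_le_mono (moment_le_cst P ler01) => // [w|].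
      by rewrite ler01 lexx.
    by rewrite /K2 -!addrA lerDl !addr_ge0// ltW.
  case: n => [|[|k]]; [exact: m1|exact: m1|].
  rewrite /K2; apply: (@moment_leD _ _ _ _ (fun w => 1 + sqn (Wb1 k.+2 w) + sqn (Wb2 k.+1 w))
    (fun w => (g k.+1)^-1 * sqn (mu k.+1 w))).
    apply: (@moment_leD _ _ _ _ (fun w => 1 + sqn (Wb1 k.+2 w))); last exact: mom2.
    apply: (@moment_leD _ _ _ _ (fun=> 1)); last exact: mom1.
    exact: moment_le_cst.
  have gk := g_gt0 (ltn0Sn k).
  have -> : K1 = (g k.+1)^-1 * (K1 * g k.+1) by rewrite mulrCA mulVf ?mulr1// gt_eqF.
  by apply: moment_leZ; [rewrite invr_ge0 ltW|exact: hmu].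
have chi1 n w : 1 <= chi n w.
  case: n => [|[|k]]//=; rewrite -!addrA lerDl !addr_ge0 ?sqn_ge0//.
  by rewrite mulr_ge0 ?sqn_ge0// invr_ge0 ltW// g_gt0.
have [B [a [g0 [C [a0 g00 C0 hC hcontr]]]]] := hurwitz_lyapunov hJ.
have [C1 C10 hC1] := sqn_mulmx B.
have a4 : 0 < a / 4 by rewrite divr_gt0.
pose kap n := Num.max 0 (1 - a / 4 * g n).
have kap0 n : 0 <= kap n by rewrite le_max lexx.
pose xi := fix xi n w : R := if n is n'.+1 then
  kap n * xi n' w + g n ^+ 2 * chi n w else 0.
(* [c] follows the recursion of [xi] with [chi] replaced by the bound [K2] on its expectation;
   [step_recursion_bound] makes it of order [g n]. *)
pose c := fix c n : R := if n is n'.+1 then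
  kap n * c n' + g n ^+ 2 * K2 else 0.
have mxi n : moment_le P (xi n) (c n).
  elim: n => [|n IH]; first exact: moment_le_cst.
  apply: (@moment_leD _ _ _ _ (fun w => kap n.+1 * xi n w)
    (fun w => g n.+1 ^+ 2 * chi n.+1 w)); apply: moment_leZ => //; exact: sqr_ge0.
have [K3 K30 hc] : exists2 K, 0 < K & forall n, (0 < n)%N -> c n <= K * g n.
  have [N _ hN] := g_small (divr_gt0 ltr01 a4).
  apply: (step_recursion_bound (N := N) (C := K2) g_gt0 g_small g_log a4).
    by move=> n _; exact: moment_le_ge0 (mxi n).
  move=> n nN; rewrite /c -/c /kap max_r 1?mulrC; first by rewrite [X in _ + X]mulrC.
  have := hN n.+1 (leqW nN); rewrite /= ltr_pdivlMr// subr_ge0 mulrC => /ltW.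
  by [].
(* Chosen so that [g n * eta n w] is the pathwise bound [xi n w + g n * chi n.+1 w] plus [g n];
   dividing [xi n] by [g n] still leaves a bounded expectation. *)
pose eta n w : R := if n is 0 then 1 else 1 + (g n)^-1 * xi n w + chi n.+1 w.
pose K := 1 + K3 + K2.
have K20 : 0 <= K2 := moment_le_ge0 (mchi 0%N).
have xi0 n w : 0 <= xi n w by have [] := mxi n.
exists eta, K; split.
- case=> [|n].
    rewrite (_ : eta 0%N = fun=> 1)//; apply: moment_le_mono (moment_le_cst P ler01) => // [w|].
      by rewrite ler01 lexx.
    by rewrite /K -!addrA lerDl addr_ge0// ltW.
  have gn := g_gt0 (ltn0Sn n).
  apply: (@moment_leD _ _ _ _ (fun w => 1 + (g n.+1)^-1 * xi n.+1 w)); last exact: mchi.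
  apply: (@moment_leD _ _ _ _ (fun=> 1)); first exact: moment_le_cst.
  apply: (@moment_le_mono _ _ _ _ (fun w => (g n.+1)^-1 * xi n.+1 w) _ ((g n.+1)^-1 * c n.+1)) => //.
  + by have [] := moment_leZ (ltW (etrans (invr_gt0 (g n.+1)) gn)) (mxi n.+1).
  + by move=> w; rewrite lexx andbT mulr_ge0// invr_ge0 ltW.
  + by rewrite mulrC ler_pdivrMr// hc.
  + by apply: moment_leZ => //; rewrite invr_ge0 ltW.
- case=> // n w; rewrite /eta -addrA lerDl addr_ge0//.
    by rewrite mulr_ge0// invr_ge0 ltW// g_gt0.
  exact: le_trans ler01 (chi1 _ _).
near=> w => Lw Aw.
have [b1 hb1] : exists M, forall n, (0 < n)%N -> `|W1 n w| <= M by near: w.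
have [b2 hb2] : exists M, forall n, (0 < n)%N -> `|W2 n w| <= M by near: w.
have iAk : L w -> (fun k => (\1_(Ak k) w : R)) @ \oo --> (\1_A w : R) by near: w.
have ev := trunc_noise_eventually Aw (iAk Lw).
have ind : (\1_L w : R) = 1 /\ (\1_A w : R) = 1 by rewrite !indicE !mem_set.
have [Cr Cr0 hrho] := remainder_small Lw.
have [M' [N hN]] : exists M' N, forall n, (N <= n)%N ->
    sqn (theta n w - ths) <= M' * (xi n w + g n * chi n.+1 w).
  apply: (@pathwise_rate_bound R d (d + d) J B a C C1 a0 C0 C10 hC hC1 g
    (fun n => theta n w - ths) (fun n => h (theta n w)) (fun n => mu n w)
    (fun n => e n w) (fun n => trunc_noise Ak e n w) (fun n => r n w)
    (fun n => r1 n w) (fun n => r2 n w)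
    (fun n => if n is 0 then 0 else sqn (Wb1 n w)) (fun n => if n is 0 then 0 else sqn (Wb2 n w))
    (fun n => chi n w) (fun n => xi n w) (b1 ^+ 2 + b2 ^+ 2) Cr g_gt0 g_small g_log) => //.
  - have := g_small g00; apply: filter_app; exists 1%N => // n /= n0 gn x.
    by apply: hcontr; rewrite ltW// g_gt0.
  - move=> n; rewrite {1}/theta/= -/theta.
    rewrite [LHS]addrAC; congr (_ + _); rewrite [LHS]addrAC; congr (_ + _).
    by rewrite [LHS]addrAC.
  - by move=> n n0; exact: rE.
  - exact: error_small.
  - by rewrite addr_ge0 ?sqr_ge0.
  - move=> [//|n] _; have gn := g_gt0 (ltn0Sn n).
    have := eW1 n.+1 isT w; rewrite ind.1 ind.2 !mulr1 => E.
    have -> : r1 n.+1 w = Num.sqrt (g n.+1) *: (W1 n.+1 w *: Wb1 n.+1 w).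
      by rewrite -E scalerA mulfV ?scale1r// gt_eqF// sqrtr_gt0.
    rewrite !sqnZ sqr_sqrtr ?(ltW gn)// mulrA ler_wpM2r ?sqn_ge0// mulrC ler_wpM2r ?(ltW gn)//.
    rewrite -[W1 _ _ ^+ 2]real_normK ?num_real//.
    apply: (@le_trans _ _ (b1 ^+ 2)); last by rewrite lerDl sqr_ge0.
    by have bb := hb1 n.+1 isT; rewrite ler_sqr ?nnegrE// (le_trans _ bb).
  - move=> [//|n] _; have gn := g_gt0 (ltn0Sn n).
    have := eW2 n.+1 isT w; rewrite ind.1 ind.2 !mulr1 => E.
    have -> : g n.+1 * sqn (\sum_(1 <= k < n.+2) r2 k w) =
       sqn (W2 n.+1 w *: Wb2 n.+1 w) by rewrite -E sqnZ sqr_sqrtr ?ltW.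
    rewrite sqnZ ler_wpM2r ?sqn_ge0//.
    rewrite -[W2 _ _ ^+ 2]real_normK ?num_real//.
    apply: (@le_trans _ _ (b2 ^+ 2)); last by rewrite lerDr sqr_ge0.
    by have bb := hb2 n.+1 isT; rewrite ler_sqr ?nnegrE// (le_trans _ bb).
  - by case=> // n; exact: sqn_ge0.
  - by case=> // n; exact: sqn_ge0.
  - by move=> [//|n] _; rewrite /chi [_ / _]mulrC lerD2r -addrA lerDr.
have [M'' _ hM''] : exists2 M'', 0 < M'' & forall n, (0 < n)%N ->
    sqn (theta n w - ths) <= M'' * (g n * eta n w).
  apply: (@eventually_dominated R (fun n => sqn (theta n w - ths))
    (fun n => g n * eta n w) N.+1 `|M'|).
    move=> [//|n] _; rewrite mulr_gt0 ?g_gt0//.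
    rewrite /eta -addrA ltr_pwDl// addr_ge0//.
      by rewrite mulr_ge0// invr_ge0 ltW// g_gt0.
    exact: le_trans ler01 (chi1 _ _).
  move=> [//|n] nN; have gn := g_gt0 (ltn0Sn n).
  apply: le_trans (hN n.+1 (ltnW nN)) _.
  have pos : 0 <= xi n.+1 w + g n.+1 * chi n.+2 w.
    by rewrite addr_ge0// mulr_ge0 ?(ltW gn)// (le_trans ler01).
  apply: le_trans (ler_wpM2r pos (ler_norm M')) _; rewrite ler_wpM2l//.
  have -> : g n.+1 * eta n.+1 w = g n.+1 + (xi n.+1 w + g n.+1 * chi n.+2 w).
    by rewrite /eta; field; rewrite gt_eqF.
  by rewrite lerDr ltW.
by exists M''.
Unshelve. all: by end_near.
Qed.

Hypothesis g_inf : (fun n => n%:R * g n) @ \oo --> +oo.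
Hypothesis g_var : (fun n => (Num.sqrt n%:R)^-1 *
  \sum_(1 <= k < n.+1) (Num.sqrt (g k))^-1 * `|1 - g k / g k.+1|) @ \oo --> (0 : R).
Hypothesis g_sum : (fun n => (Num.sqrt n%:R)^-1 * \sum_(1 <= k < n.+1) g k)
  @ \oo --> (0 : R).

(** [c n] is the majorant with [eta] and the squared truncated noise replaced by the bounds [K] and
    [Me] on their expectations; each of its terms vanishes by a step-size condition or is of order
    [1 / sqrt n]. *)
Lemma averaging_error (t : 'rV[R]_d) :
  let s := - (t *m invmx (grad h ths)) in
  exists (zeta : nat -> T -> R) (c : nat -> R),
  [/\ forall n, moment_le P (zeta n) (c n), c @ \oo --> (0 : R) &
   {ae P, forall w, L w -> A w -> exists M, forall n, (0 < n)%N ->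
   `|Num.sqrt n%:R * dotp t (avg_iter theta n w - ths)
     - dotp s ((Num.sqrt n.+1%:R)^-1 *: \sum_(k < n.+1) e k.+1 w)
     - Num.sqrt n%:R / n.+1%:R * dotp s (\sum_(k < n.+1) r k.+1 w)| <= M * zeta n w}].
Proof.
move=> s; have [eta [K [meta eta1 aeD]]] := averaging_rate.
have [Me hMe] := @trunc_noise_moment _ _ _ P d F e Ak hF he hA hM.
have K0 : 0 <= K := moment_le_ge0 (meta 0%N).
have Me0 : 0 <= Me := moment_le_ge0 (hMe 1%N isT).
pose zeta n w := error_majorant g (eta ^~ w) (fun k => sqn (trunc_noise Ak e k w)) n.
pose c n := (Num.sqrt n%:R)^-1 * ((Num.sqrt (g n.+1))^-1 * K
   + \sum_(1 <= k < n.+1) ((Num.sqrt (g k))^-1 * `|1 - g k / g k.+1|) * K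
   + \sum_(1 <= k < n.+1) g k * K + 1
   + n.+1%:R^-1 * \sum_(k < n.+1) (1 + Me)).
exists zeta, c; split.
- move=> n; have sumK (b : nat -> R) : (forall k, (0 < k)%N -> 0 <= b k) ->
      moment_le P (fun w => \sum_(1 <= k < n.+1) b k * eta k w)
        (\sum_(1 <= k < n.+1) b k * K).
    move=> b0; rewrite big_add1 big_mkord.
    rewrite (_ : (fun w => _) = fun w => \sum_(k < n) b k.+1 * eta k.+1 w); last first.
      by apply/funext => w; rewrite big_add1 big_mkord.
    by apply: moment_le_sum => k; apply: moment_leZ => //; exact: b0.
  apply: moment_leZ; first by rewrite invr_ge0 sqrtr_ge0.
  apply: (@moment_leD _ _ _ P (fun w => (Num.sqrt (g n.+1))^-1 * eta n.+1 w
    + \sum_(1 <= k < n.+1) ((Num.sqrt (g k))^-1 * `|1 - g k / g k.+1|) * eta k w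
    + \sum_(1 <= k < n.+1) g k * eta k w + 1)
    (fun w => n.+1%:R^-1 * \sum_(k < n.+1) (1 + sqn (trunc_noise Ak e k.+1 w)))).
    apply: moment_leD; last exact: moment_le_cst.
    apply: moment_leD; last by apply: sumK => k k0; rewrite ltW// g_gt0.
    apply: moment_leD.
      by apply: moment_leZ => //; rewrite invr_ge0 sqrtr_ge0.
    by apply: sumK => k _; rewrite mulr_ge0// invr_ge0 sqrtr_ge0.
  apply: moment_leZ => //; apply: moment_le_sum => k.
  by apply: moment_leD; [exact: moment_le_cst|exact: hMe].
(* [2 + Me] collects the constant 1 and the average of the equal terms [1 + Me]. *)
- have cE : c = (fun n => ((Num.sqrt n%:R)^-1 * (Num.sqrt (g n.+1))^-1) * K
     + ((Num.sqrt n%:R)^-1 * \sum_(1 <= k < n.+1) (Num.sqrt (g k))^-1 * `|1 - g k / g k.+1|) * K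
     + ((Num.sqrt n%:R)^-1 * \sum_(1 <= k < n.+1) g k) * K
     + (Num.sqrt n%:R)^-1 * (2 + Me)).
    apply/funext => n; rewrite /c -!mulr_suml sumr_const card_ord -[(1 + Me) *+ _]mulr_natl.
    by rewrite mulKf ?pnatr_eq0//; ring.
  rewrite cE -[0 in X in _ --> X](_ : 0 * K + 0 * K + 0 * K + 0 * (2 + Me) = 0); last by ring.
  apply: cvgD; last by apply: cvgMl; exact: inv_sqrt_cvg0.
  apply: cvgD; last by apply: cvgMl; exact: g_sum.
  apply: cvgD; apply: cvgMl; first exact: inv_sqrt_step_cvg0.
  exact: g_var.
near=> w => Lw Aw.
have aeDw : L w -> A w -> exists M, forall n, (0 < n)%N ->
  sqn (theta n w - ths) <= M * (g n * eta n w) by near: w.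
have [M hM'] := aeDw Lw Aw.
have iAk : L w -> (fun k => (\1_(Ak k) w : R)) @ \oo --> (\1_A w : R) by near: w.
have [N1 _ ev] := trunc_noise_eventually Aw (iAk Lw).
have [Cr Cr0 [N2 _ hrho]] := remainder_small Lw.
have geta n : (0 < n)%N -> 0 < g n * eta n w.
  by move=> n0; rewrite mulr_gt0 ?g_gt0// (lt_le_trans ltr01).
have hD n : (0 < n)%N -> sqn (theta n w - ths) <= `|M| * (g n * eta n w).
  move=> n0; apply: le_trans (hM' n n0) _.
  by apply: ler_wpM2r; [exact/ltW/geta|exact: ler_norm].
have [Mr Mr0 hr] : exists2 Mr, 0 < Mr & forall n, (0 < n)%N ->
    `|h (theta n w) - (theta n w - ths) *m J| <= Mr * (g n * eta n w).
  apply: (@eventually_dominated R (fun n => `|h (theta n w) - (theta n w - ths) *m J|)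
    (fun n => g n * eta n w) N2.+1 ((1 + Cr) * `|M|)); first exact: geta.
  move=> k kN; have k0 : (0 < k)%N by exact: leq_ltn_trans kN.
  have Cr1 : 0 <= 1 + Cr by rewrite addr_ge0// ltW.
  apply: (@le_trans _ _ ((1 + Cr) * sqn (theta k w - ths))); last first.
    by rewrite -mulrA ler_wpM2l// hD.
  rewrite -(@ler_pXn2r _ 2)// ?nnegrE ?mulr_ge0 ?sqn_ge0//.
  apply: le_trans (norm_sqn_le _) (le_trans (hrho k (ltnW kN)) _).
  rewrite exprMn ler_wpM2r ?sqr_ge0//; have := sqr_ge0 Cr; lra.
have [Me' Me'0 hE] : exists2 Me', 0 < Me' & forall n, (0 < n)%N ->
    `|e n w| <= Me' * (1 + sqn (trunc_noise Ak e n w)).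
  apply: (@eventually_dominated R (fun n => `|e n w|)
    (fun n => 1 + sqn (trunc_noise Ak e n w)) N1 1).
    by move=> n _; rewrite ltr_pwDl// sqn_ge0.
  move=> n nN; rewrite mul1r (ev n nN) -/(trunc_noise Ak e n w).
  have := norm_sqn_le (trunc_noise Ak e n w).
  have := sqr_ge0 (`|trunc_noise Ak e n w| - 1).
  have := normr_ge0 (trunc_noise Ak e n w); lra.
have Ju : J \in unitmx by rewrite -unitmx_tr; exact: hurwitz_unit.
have Dstep n : theta n.+1 w - ths = (theta n w - ths) + g n.+1 *: h (theta n w)
    + g n.+1 *: e n.+1 w + g n.+1 *: r n.+1 w.
  rewrite {1}/theta/= -/theta [LHS]addrAC; congr (_ + _).
  by rewrite [LHS]addrAC; congr (_ + _); rewrite [LHS]addrAC.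
have [M4 hM4] := @path_error_bound R d J g g_gt0 (fun k => theta k w - ths)
  (fun k => h (theta k w)) (fun k => e k w) (fun k => r k w) Dstep (eta ^~ w)
  (fun k => sqn (trunc_noise Ak e k w)) `|M| Mr Me' (normr_ge0 M) (ltW Mr0) (ltW Me'0)
  (fun n => eta1 n w) (fun k => sqn_ge0 (trunc_noise Ak e k w)) hr hD hE t Ju.
exists M4 => n n0; have := hM4 n n0.
have -> // : avg_iter theta n w - ths = n.+1%:R^-1 *: \sum_(k < n.+1) (theta k w - ths).
rewrite sumrB sumr_const card_ord scalerBr; congr (_ - _).
by rewrite -[ths *+ _]scaler_nat scalerA mulVf ?scale1r// pnatr_eq0.
Unshelve. all: by end_near.
Qed.

End RateOfConvergence.

(** * Transfer of the limit *)

Section Slutsky.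
Context {dT : measure_display} {T : measurableType dT} {R : realType}.
Variable P : probability T R.

Lemma moment_le_indic (B : set T) (c : R) : measurable B -> (P B <= c%:E)%E ->
  moment_le P (fun w => \1_B w) c.
Proof.
move=> mB Bc; split => //; first exact: measurable_indic.
by rewrite integral_indic// setIT.
Qed.

Variables (L : set T) (mL : measurable L) (A : nat -> set T).
Hypothesis mA : forall m, (0 < m)%N -> measurable (A m).
Hypothesis AL : (fun m => fine (P (A m `&` L)) / fine (P L)) @ \oo --> (1 : R).

(** The limit of conditional probabilities is multiplied by [P L], which is at most 1, and becomes
    smallness of the part of [L] outside [A m]. *)
Lemma exhausting_sets eps : 0 < eps ->
  exists2 m, (0 < m)%N & (P (L `\` A m) <= eps%:E)%E.
Proof.
move=> eps0; pose del := Num.min 1 eps.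
have del0 : 0 < del by rewrite lt_min ltr01.
have /cvgrPdist_lt/(_ _ del0)[N _ hN] := AL.
exists N.+1 => //; have := hN N.+1 (leqnSn N) => /= h.
have mAN := mA (ltn0Sn N).
have pf (B : set T) : measurable B -> P B \is a fin_num by exact: fin_num_measure.
have mI := measurableI _ _ mAN mL; have mD := measurableD mL mAN.
have pE : fine (P L) = fine (P (A N.+1 `&` L)) + fine (P (L `\` A N.+1)).
  by rewrite -fineD ?pf// setIC addeC -measureDI.
have p1 : fine (P L) <= 1 by rewrite -lee_fin fineK ?pf// probability_le1.
have p0 : 0 <= fine (P L) by rewrite fine_ge0.
rewrite -[X in (X <= _)%E]fineK ?pf// lee_fin.
(* A quotient by zero is zero here, so it cannot come within [del <= 1] of 1. *)
have [z|nz] := eqVneq (fine (P L)) 0.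
  by have : 1 < del; [move: h; rewrite z invr0 mulr0 subr0 normr1|rewrite lt_min ltxx].
have {}p0 : 0 < fine (P L) by rewrite lt_neqAle eq_sym nz.
have E : 1 - fine (P (A N.+1 `&` L)) / fine (P L) = fine (P (L `\` A N.+1)) / fine (P L).
  by rewrite pE; field; rewrite -pE.
rewrite E in h; have {}h := le_lt_trans (ler_norm _) h.
rewrite ltr_pdivrMr// in h.
apply: le_trans (ltW h) _; apply: (@le_trans _ _ del); first by rewrite ler_piMr// ltW.
by rewrite ge_min lexx orbT.
Qed.

(* The random constant [M] need not be measurable in [w], but the sets of points at
   which a given integer can play its role are. *)
Lemma dominated_exhaustion (B : set T) (Z zeta : nat -> T -> R) eps : measurable B ->
  (forall n, measurable_fun setT (Z n)) -> (forall n, measurable_fun setT (zeta n)) ->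
  (forall n w, 0 <= zeta n w) ->
  {ae P, forall w, B w -> exists M, forall n, (0 < n)%N -> `|Z n w| <= M * zeta n w} ->
  0 < eps ->
  exists K : nat, exists2 G : set T, measurable G &
    (forall w n, G w -> (0 < n)%N -> `|Z n w| <= K%:R * zeta n w) /\
    (P (B `\` G) <= eps%:E)%E.
Proof.
move=> mB mZ mz z0 aeB eps0.
pose G K := \bigcap_(n in [set n | (0 < n)%N])
  [set w | `|Z n w| <= K%:R * zeta n w].
have mG K : measurable (G K).
  apply: bigcap_measurableType => n _.
  rewrite -[X in measurable X]setTI.
  have : measurable_fun setT (fun w => `|Z n w| <= K%:R * zeta n w).
    apply: measurable_fun_ler; first exact: measurableT_comp.
    exact: measurable_funM.
  by move=> /(_ measurableT [set true]); apply.
have mBG K : measurable (B `\` G K) by exact: measurableD.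
have cv : P (B `\` G K) @[K --> \oo] --> P (\bigcap_K (B `\` G K)).
  apply: nonincreasing_cvg_mu => //.
  - by rewrite -ge0_fin_numE ?fin_num_measure.
  - exact: bigcapT_measurable.
  - move=> K K' KK'; apply/subsetPset => w [Bw nG]; split => // GK; apply: nG => n n0.
    by apply: le_trans (GK n n0) _; rewrite ler_wpM2r// ler_nat.
(* At almost every point of [B] some finite constant works, and so does every larger integer; such a
   point lies outside the intersection. *)
have z : P (\bigcap_K (B `\` G K)) = 0%E.
  apply/eqP; rewrite eq_le measure_ge0 andbT.
  case: aeB => N [mN PN hN]; rewrite -PN; apply: le_measure; rewrite ?inE//.
    exact: bigcapT_measurable.
  move=> w hw; apply: hN => /= h; have [Bw _] := hw 0%N I.
  have [M hM] := h Bw.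
  have [_] := hw (Num.truncn `|M|).+1 I; apply => n n0.
  apply: le_trans (hM n n0) _; rewrite ler_wpM2r// (le_trans (ler_norm M))// ltW//.
  exact: truncnS_gt.
rewrite z in cv; have /fine_cvgP[_ /cvgr0Pnorm_lt/(_ _ eps0)[K _ /(_ K (leqnn K))]] := cv.
move=> /= hK; exists K, (G K) => //; split.
  by move=> w n Gw n0; exact: Gw.
rewrite -[X in (X <= _)%E]fineK ?fin_num_measure// lee_fin.
exact: le_trans (ler_norm _) (ltW hK).
Qed.

Variables X Y q : nat -> T -> R.
Hypotheses (mX : forall n, measurable_fun setT (X n)) (mY : forall n, measurable_fun setT (Y n))
  (mq : forall n, measurable_fun setT (q n)).
Hypothesis dom : forall m, (0 < m)%N -> exists (zeta : nat -> T -> R) (c : nat -> R),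
  [/\ forall n, moment_le P (zeta n) (c n), c @ \oo --> (0 : R) &
   {ae P, forall w, L w -> A m w -> exists M, forall n, (0 < n)%N ->
     `|X n w - Y n w - q n w| <= M * zeta n w}].
Hypothesis hq : forall del, 0 < del -> exists B : nat -> set T,
  [/\ forall n, measurable (B n), (fun n => P (B n)) @ \oo --> 0%E &
    forall n w, (0 < n)%N -> L w -> ~ B n w -> `|q n w| <= del].

(** On [L], outside three events of small probability (the complement of [A m], the points not in
    [G], and [B n]), the distance is at most [K * zeta n + del], and for fixed [K] the expectation
    of [K * zeta n] vanishes. The order of choices matters: [m], then [K], then [n]. Truncation at 2
    limits the cost of the exceptional events. *)
Lemma truncated_difference_small eps : 0 < eps -> \forall n \near \oo,
  moment_le P (fun w => (\1_L w : R) * Num.min 2 `|X n w - Y n w|) eps.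
Proof.
(* Eight shares: two for each of the three exceptional events, one for [K * zeta n], one for
   [q n]. *)
move=> eps0; pose del := eps / 8; have del0 : 0 < del by rewrite divr_gt0.
have [m m0 Pm] := exhausting_sets del0.
have [zeta [c [mz c0 aeB]]] := dom m0.
have mAm := mA m0.
have mLA : measurable (L `&` A m) by exact: measurableI.
pose Z n w := X n w - Y n w - q n w.
have mZ n : measurable_fun setT (Z n).
  by apply: measurable_funB => //; exact: measurable_funB.
have [K [G mG [hG PG]]] : exists K : nat, exists2 G : set T, measurable G &
    (forall w n, G w -> (0 < n)%N -> `|Z n w| <= K%:R * zeta n w) /\
    (P ((L `&` A m) `\` G) <= del%:E)%E.
  apply: dominated_exhaustion => //.
  - by move=> n; case: (mz n).
  - by move=> n w; case: (mz n).
  - by apply: filterS aeB => w h [Lw Aw]; exact: h.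
have [B [mB PB hB]] := hq del0.
have [N1 _ hN1] : \forall n \near \oo, (P (B n) <= del%:E)%E.
  have /fine_cvgP[_ /cvgr0Pnorm_lt/(_ _ del0)] := PB; apply: filterS => n /= h.
  rewrite -[X in (X <= _)%E]fineK ?fin_num_measure// lee_fin.
  exact: le_trans (ler_norm _) (ltW h).
have dK : 0 < del / K.+1%:R by rewrite divr_gt0.
have [N2 _ hN2] := cvgr0_norm_lt _ c0 _ dK.
exists (maxn N1 N2).+1 => // n /= nN.
have n0 : (0 < n)%N by exact: leq_ltn_trans nN.
have /hN1 PBn : (N1 <= n)%N by apply: ltnW; apply: leq_ltn_trans nN; exact: leq_maxl.
have /hN2/= cn : (N2 <= n)%N by apply: ltnW; apply: leq_ltn_trans nN; exact: leq_maxr.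
have Kc : K%:R * c n <= del.
  have c0n := moment_le_ge0 (mz n).
  rewrite ger0_norm// ltr_pdivlMr// in cn; apply: le_trans (ltW cn); rewrite mulrC ler_wpM2l//.
  by rewrite ler_nat.
have m1 := moment_leZ (ler0n R 2) (moment_le_indic (measurableD mL mAm) Pm).
have m2 := moment_leZ (ler0n R 2) (moment_le_indic (measurableD mLA mG) PG).
have m3 := moment_leZ (ler0n R 2) (moment_le_indic (mB n) PBn).
have m4 := moment_leZ (ler0n R K) (mz n).
have m5 := moment_le_cst P (ltW del0).
have ms := moment_leD (moment_leD (moment_leD (moment_leD m1 m2) m3) m4) m5.
apply: moment_le_mono ms.
- apply: measurable_funM; first exact: measurable_indic.
  apply: measurable_minr => //; apply: measurableT_comp => //; exact: measurable_funB.
- have z0 : forall w, 0 <= zeta n w by case: (mz n).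
  move=> w; have min0 : 0 <= Num.min 2 `|X n w - Y n w| by rewrite le_min normr_ge0 ler0n.
  have ind0 (D : set T) : 0 <= (\1_D w : R) by rewrite indicE.
  rewrite mulr_ge0//=.
  have Kz : 0 <= K%:R * zeta n w by rewrite mulr_ge0.
  have i1 := ind0 (L `\` A m); have i2 := ind0 ((L `&` A m) `\` G); have i3 := ind0 (B n).
  have d0 := ltW del0.
  case: (pselect (L w)) => Lw; last first.
    rewrite {1}indicE memNset// mul0r; lra.
  rewrite {1}indicE mem_set// mul1r.
  have min2 : Num.min 2 `|X n w - Y n w| <= 2 by rewrite ge_min lexx.
  case: (pselect (A m w)) => Aw; last first.
    have e1 : (\1_(L `\` A m) w : R) = 1 by rewrite indicE mem_set.
    by rewrite e1; lra.
  case: (pselect (G w)) => Gw; last first.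
    have e1 : (\1_(L `&` A m `\` G) w : R) = 1 by rewrite indicE mem_set.
    by rewrite e1; lra.
  case: (pselect (B n w)) => Bw.
    have e1 : (\1_(B n) w : R) = 1 by rewrite indicE mem_set.
    by rewrite e1; lra.
  have h1 := hG w n Gw n0; have h2 := hB n w n0 Lw Bw.
  have h3 : Num.min 2 `|X n w - Y n w| <= `|X n w - Y n w| by rewrite ge_min lexx orbT.
  have h4 : `|X n w - Y n w| <= `|Z n w| + `|q n w|.
    have -> : X n w - Y n w = Z n w + q n w by rewrite subrK.
    exact: ler_normD.
  lra.
- have -> : eps = 8 * del by rewrite /del; field.
  lra.
Qed.

(** Being bounded by 1 and 1-Lipschitz, [f] changes by at most the minimum of 2 and the distance, so
    the two integrals differ by at most the expectation of the truncated distance. *)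
Lemma integral_lipschitz_cvg (f : R -> R) (l : \bar R) : measurable_fun setT f ->
  (forall x, `|f x| <= 1) -> (forall x y, `|f x - f y| <= `|x - y|) ->
  (fun n => \int[P]_w ((\1_L w : R) * f (Y n w))%:E)%E @ \oo --> l ->
  (fun n => \int[P]_w ((\1_L w : R) * f (X n w))%:E)%E @ \oo --> l.
Proof.
move=> mf f1 flip cY.
have mi : measurable_fun setT (\1_L : T -> R) by exact: measurable_indic.
have int (g : T -> R) : measurable_fun setT g -> (forall w, `|g w| <= 2) ->
    P.-integrable setT (fun w => ((\1_L w : R) * g w)%:E).
  move=> mg g2; apply: le_integrable (moment_le_integrable (moment_le_cst P (ler0n R 2))) => //.
    by apply/measurable_EFinP; exact: measurable_funM.
  move=> w _; rewrite /= lee_fin normrM indicE.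
  by case: (w \in L) => /=; rewrite ?normr1 ?normr0 ?mul1r ?mul0r [leRHS]ger0_norm//.
have mfX n : measurable_fun setT (fun w => f (X n w)) by exact: measurableT_comp.
have mfY n : measurable_fun setT (fun w => f (Y n w)) by exact: measurableT_comp.
have f2 x y : `|f x - f y| <= 2.
  by apply: le_trans (ler_normB _ _) _; have := f1 x; have := f1 y; lra.
have f12 x : `|f x| <= 2 by apply: le_trans (f1 x) _; rewrite ler1n.
pose D n := (\int[P]_w ((\1_L w : R) * (f (X n w) - f (Y n w)))%:E)%E.
have intD n : P.-integrable setT (fun w => ((\1_L w : R) * (f (X n w) - f (Y n w)))%:E).
  by apply: int => //; exact: measurable_funB.
have E : (fun n => \int[P]_w ((\1_L w : R) * f (X n w))%:E)%E =
    (fun n => \int[P]_w ((\1_L w : R) * f (Y n w))%:E + D n)%E.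
  apply/funext => n; rewrite /D -integralD//; last exact: int.
  by apply: eq_integral => w _; rewrite -EFinD; congr EFin; ring.
have Dfin n : D n \is a fin_num by exact: integrable_fin_num.
have D0 : D n @[n --> \oo] --> 0%E.
  apply/fine_cvgP; split; first exact: nearW.
  apply/cvgr0Pnorm_lt => eps eps0.
  have e2 : 0 < eps / 2 by rewrite divr_gt0.
  have := truncated_difference_small e2; apply: filterS => n [mm mm0 hm] /=.
  apply: (@le_lt_trans _ _ (eps / 2)); last by lra.
  rewrite -lee_fin.
  have -> : (`|fine (D n)|%:E = `|D n|)%E by rewrite -[in RHS](fineK (Dfin n)).
  apply: le_trans hm; apply: le_trans (le_abse_integral P measurableT _) _.
    by have /integrableP[] := intD n.
  apply: ge0_le_integral => //.
  - by apply: measurableT_comp => //; have /integrableP[] := intD n.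
  - exact/measurable_EFinP.
  - move=> w _; rewrite /= lee_fin normrM ger0_norm ?indicE// ler_wpM2l//.
    by rewrite le_min f2 flip.
rewrite E -[l]adde0; apply: cvgeD => //.
by rewrite fin_num_adde_defl.
Qed.

End Slutsky.

(** * Lipschitz bounds for cosine and sine *)

Section Trigonometry.
Variable R : realType.

Let lipschitz1 (f df : R -> R) : (forall x : R, is_derive x 1 f (df x)) ->
  (forall x, `|df x| <= 1) -> forall x y, `|f x - f y| <= `|x - y|.
Proof.
move=> hf df1 x y; wlog xy : x y / y <= x.
  move=> H; case: (leP y x) => [/H//|/ltW/H].
  by rewrite distrC [`|y - x|]distrC.
have [|c _ ->] := @MVT_segment R f df y x xy (fun z _ => hf z).
  by apply: derivable_within_continuous => z _; case: (hf z).
by rewrite normrM ler_piMl.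
Qed.

Lemma cos_lipschitz (x y : R) : `|cos x - cos y| <= `|x - y|.
Proof.
apply: (@lipschitz1 cos (fun x => - sin x)) => z.
by rewrite normrN ler_norml sin_geN1 sin_le1.
Qed.

Lemma sin_lipschitz (x y : R) : `|sin x - sin y| <= `|x - y|.
Proof.
apply: (@lipschitz1 sin cos) => z.
by rewrite ler_norml cos_geN1 cos_le1.
Qed.

End Trigonometry.

(** * Measurability of the iterates and the limit theorem *)

Lemma vmeasurable_sa_iter (R : realType) (d : nat) (dT : measure_display)
  (T : measurableType dT) (Theta : set 'rV[R]_d) (h : 'rV[R]_d -> 'rV[R]_d)
  (gam : nat -> R) (e r : nat -> T -> 'rV[R]_d) (th0 : 'rV[R]_d) n :
  meas_on_dom Theta h -> (forall n w, Theta (sa_iter h gam e r th0 n w)) ->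
  (forall n, (0 < n)%N -> vmeasurable (e n)) ->
  (forall n, (0 < n)%N -> vmeasurable (r n)) ->
  vmeasurable (sa_iter h gam e r th0 n).
Proof.
move=> mh hT me mr; elim: n => [|n IH]; first exact: vmeasurable_cst.
have cst : measurable_fun setT (fun _ : T => gam n.+1) by exact: measurable_cst.
apply: vmeasurableD; last by apply: vmeasurableZ => //; exact: mr.
apply: vmeasurableD; last by apply: vmeasurableZ => //; exact: me.
apply: vmeasurableD => //; apply: vmeasurableZ => //.
exact: meas_on_dom_comp mh (hT n) IH.
Qed.

Theorem theorem2 (R : realType) (d : nat) (dT : measure_display)
  (T : measurableType dT) (P : probability T R) (F : nat -> set (set T))
  (Theta : set 'rV[R]_d) (h : 'rV[R]_d -> 'rV[R]_d) (gam : nat -> R)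
  (e r r1 r2 : nat -> T -> 'rV[R]_d) (th0 ths : 'rV[R]_d)
  (A : nat -> set T) (Amk : nat -> nat -> set T) (U : T -> 'M[R]_d) :
  (* standing assumptions *)
  filtration F ->
  meas_on_dom Theta h ->
  (forall n, (0 < n)%N -> 0 < gam n) ->
  Theta th0 ->
  (forall n w, Theta (sa_iter h gam e r th0 n w)) ->
  Theta ths ->
  let theta := sa_iter h gam e r th0 in
  let L := [set w | (fun q => theta q w) @ \oo --> ths] in
  (* (C1) *)
  interior Theta ths ->
  h ths = 0 ->
  (exists V, nbhs ths V /\ C2_on V h) ->
  hurwitz (grad h ths) ->
  (* (C4a) *)
  ((fun n => \sum_(1 <= k < n.+1) gam k) @ \oo --> +oo) ->
  cvg ((fun n => \sum_(1 <= k < n.+1) gam k ^+ 2) @ \oo) ->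
  ((fun k => ln (gam k.-1 / gam k) / gam k) @ \oo --> (0 : R)) ->
  (* (AV1) (a) *)
  (forall n, (0 < n)%N -> meas_wrt (F n) (e n)) ->
  cond_mean_zero P F e ->
  (* (AV1) (b) *)
  (forall m, (0 < m)%N -> measurable (A m)) ->
  ((fun m => fine (P (A m `&` L)) / fine (P L)) @ \oo --> (1 : R)) ->
  (forall m k, (0 < m)%N -> F k (Amk m k)) ->
  (forall m, (0 < m)%N -> exists M : R, forall k, (0 < k)%N ->
     (\int[P]_w ((enorm (e k w)) ^+ 2 * (\1_(Amk m k.-1) w : R))%:E <= M%:E)%E) ->
  (forall m, (0 < m)%N ->
     {ae P, forall w, L w ->
        (fun k => (\1_(Amk m k) w : R)) @ \oo --> (\1_(A m) w : R)}) ->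
  (* (AV1) (c) *)
  meas_wrt measurable U ->
  {ae P, forall w, L w -> posdef (U w)} ->
  (forall t : 'rV[R]_d,
     cexp_lim P L
       (fun n w => dotp t ((Num.sqrt (n.+1%:R))^-1 *: \sum_(k < n.+1) e k.+1 w))
       (fun w => expR (- (qform (U w) t / 2)))) ->
  (* (AV2) *)
  (forall n, (0 < n)%N -> meas_wrt (F n) (r n)) ->
  (forall n w, (0 < n)%N -> r n w = r1 n w + r2 n w) ->
  (forall m, (0 < m)%N ->
     OwpOL2 P (fun n w => ((Num.sqrt (gam n))^-1 * (\1_L w : R) * (\1_(A m) w : R))
                            *: r1 n w)) ->
  (forall m, (0 < m)%N ->
     OwpOL2 P (fun n w => (Num.sqrt (gam n) * (\1_L w : R) * (\1_(A m) w : R))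
                            *: \sum_(1 <= k < n.+1) r2 k w)) ->
  cvg_in_prob P (fun n w => ((Num.sqrt (n%:R))^-1 * (\1_L w : R))
                              *: \sum_(k < n.+1) r k.+1 w) ->
  (* (AV3) *)
  ((fun n => n%:R * gam n) @ \oo --> +oo) ->
  ((fun n => (Num.sqrt (n%:R))^-1 *
      \sum_(1 <= k < n.+1) (Num.sqrt (gam k))^-1 * `|1 - gam k / gam k.+1|)
     @ \oo --> (0 : R)) ->
  ((fun n => (Num.sqrt (n%:R))^-1 * \sum_(1 <= k < n.+1) gam k) @ \oo --> (0 : R)) ->
  (* conclusion *)
  forall t : 'rV[R]_d,
    cexp_lim P L
      (fun n w => Num.sqrt (n%:R) * dotp t (avg_iter theta n w - ths))
      (fun w => expR (- (qform (invmx (grad h ths) *m U w *m (invmx (grad h ths))^T) t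
                          / 2))).
Proof.
move=> hF mh gam_gt0 _ hT _ theta L _ h0 hC2 hJ _ hsq hlog he he0 mA hAL hAmk hM hconv
  _ _ hclt hr hr12 hr1 hr2 hrp hng hvar hsum t.
have gam_small := summable_sqr_small gam_gt0 hsq.
have Fm n : F n `<=` measurable by case: hF => _ [].
have me n : (0 < n)%N -> vmeasurable (e n).
  by move=> n0; apply: meas_wrt_vmeasurable => B /(he n n0); exact: Fm.
have mr n : (0 < n)%N -> vmeasurable (r n).
  by move=> n0; apply: meas_wrt_vmeasurable => B /(hr n n0); exact: Fm.
have mtheta n : vmeasurable (theta n) by exact: vmeasurable_sa_iter mh hT me mr.
have mL : measurable L by exact: measurable_cvg_set.
(* Direction in which the noise limit is used: [Y n], the normalised noise along [s], is the leading
   part of [X n]. *)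
pose s := - (t *m invmx (grad h ths)).
pose X n w := Num.sqrt n%:R * dotp t (avg_iter theta n w - ths).
pose Y n w := dotp s ((Num.sqrt n.+1%:R)^-1 *: \sum_(k < n.+1) e k.+1 w).
pose q n w := Num.sqrt n%:R / n.+1%:R * dotp s (\sum_(k < n.+1) r k.+1 w).
have mX n : measurable_fun setT (X n).
  apply: measurable_funM => //; apply: measurable_dotp.
  apply: vmeasurableD; last exact: vmeasurable_cst.
  apply: (@vmeasurableZ R _ T d (fun=> n.+1%:R^-1)) => //.
  by apply: vmeasurable_sum => k; exact: mtheta.
have mY n : measurable_fun setT (Y n).
  apply: measurable_dotp.
  apply: (@vmeasurableZ R _ T d (fun=> (Num.sqrt n.+1%:R)^-1)) => //.
  by apply: vmeasurable_sum => k; exact: me.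
have msr n : vmeasurable (fun w => \sum_(k < n.+1) r k.+1 w).
  by apply: vmeasurable_sum => k; exact: mr.
have mq n : measurable_fun setT (q n).
  by apply: measurable_funM => //; exact: measurable_dotp.
have dom m : (0 < m)%N -> exists (zeta : nat -> T -> R) (c : nat -> R),
  [/\ forall n, moment_le P (zeta n) (c n), c @ \oo --> (0 : R) &
   {ae P, forall w, L w -> A m w -> exists M, forall n, (0 < n)%N ->
     `|X n w - Y n w - q n w| <= M * zeta n w}].
  move=> m0; exact: (@averaging_error _ _ _ P d F h gam e r r1 r2 th0 ths (A m) (Amk m)
    gam_gt0 gam_small hlog h0 hC2 hJ hF he he0 (fun k => hAmk m k m0) (hM m m0) (hconv m m0)
    hr12 (hr1 m m0) (hr2 m m0) hng hvar hsum t).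
(* The sums of the [r k] are controlled in probability only on [L], so the exceptional events
   contain the indicator of [L] and the bound is claimed on [L] alone. The threshold [del / Cs]
   undoes the constant of [dotp s]. *)
have hq del : 0 < del -> exists B : nat -> set T,
  [/\ forall n, measurable (B n), (fun n => P (B n)) @ \oo --> 0%E &
    forall n w, (0 < n)%N -> L w -> ~ B n w -> `|q n w| <= del].
  move=> del0; have [Cs Cs0 hCs] := dotp_le_norm s.
  have eps0 : 0 < del / Cs by rewrite divr_gt0.
  pose Z n w := ((Num.sqrt n%:R)^-1 * (\1_L w : R)) *: \sum_(k < n.+1) r k.+1 w.
  exists (fun n => [set w | del / Cs < enorm (Z n w)]); split.
  - move=> n; have mZ : vmeasurable (Z n).
      by apply: vmeasurableZ => //; apply: measurable_funM => //; exact: measurable_indic.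
    have -> : [set w | del / Cs < enorm (Z n w)] =
        (fun w => sqn (Z n w)) @^-1` `](del / Cs) ^+ 2, +oo[.
      apply/seteqP; split => w /=; rewrite in_itv/= andbT -enorm_sqr ltr_pXn2r//;
        by rewrite nnegrE ?sqrtr_ge0// ltW.
    by rewrite -[X in measurable X]setTI; apply: measurable_sqn.
  - exact: hrp.
  - move=> n w n0 Lw /negP; rewrite -leNgt => hZ.
    have sn : 0 < Num.sqrt n%:R :> R by rewrite sqrtr_gt0 ltr0n.
    have ZE : Z n w = (Num.sqrt n%:R)^-1 *: \sum_(k < n.+1) r k.+1 w.
      by rewrite /Z indicE mem_set// mulr1.
    have nZ : `|Z n w| <= del / Cs.
      apply: le_trans hZ; rewrite -(@ler_pXn2r _ 2)// ?nnegrE ?sqrtr_ge0//.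
      by rewrite enorm_sqr norm_sqn_le.
    have c1 : Num.sqrt n%:R / n.+1%:R <= (Num.sqrt n%:R)^-1 :> R.
      rewrite ler_pdivrMr// ler_pdivlMl// -expr2 sqr_sqrtr// ler_nat//.
    rewrite normrM ger0_norm ?divr_ge0 ?(ltW sn)//.
    apply: le_trans (ler_pM _ (normr_ge0 _) c1 (hCs _)) _; first by rewrite divr_ge0// ltW.
    rewrite mulrCA -ler_pdivlMl// mulrC [Cs^-1 * _]mulrC; apply: le_trans nZ.
    by rewrite ZE normrZ gtr0_norm ?invr_gt0// mulrC.
(* The minus sign of [s] occurs twice in the quadratic form and cancels. *)
have VE w : qform (invmx (grad h ths) *m U w *m (invmx (grad h ths))^T) t = qform (U w) s.
  by rewrite /qform /s linearN/= mulmxN !mulNmx opprK trmx_mul !mulmxA.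
have [ccos csin] := hclt s.
have transfer (f : R -> R) (l : \bar R) : measurable_fun setT f ->
  (forall x, `|f x| <= 1) -> (forall x y, `|f x - f y| <= `|x - y|) ->
  (fun n => \int[P]_w ((\1_L w : R) * f (Y n w))%:E)%E @ \oo --> l ->
  (fun n => \int[P]_w ((\1_L w : R) * f (X n w))%:E)%E @ \oo --> l.
  exact: (integral_lipschitz_cvg mL mA hAL mX mY mq dom hq).
split.
  have -> : (\int[P]_w ((\1_L w : R) * expR (- (qform (invmx (grad h ths) *m U w
      *m (invmx (grad h ths))^T) t / 2)))%:E)%E =
    (\int[P]_w ((\1_L w : R) * expR (- (qform (U w) s / 2)))%:E)%E.
    by apply: eq_integral => w _; rewrite VE.
  apply: (transfer cos) => //.
  - by apply: continuous_measurable_fun; exact: continuous_cos.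
  - by move=> x; rewrite ler_norml cos_geN1 cos_le1.
  - exact: cos_lipschitz.
apply: (transfer sin) => //.
- by apply: continuous_measurable_fun; exact: continuous_sin.
- by move=> x; rewrite ler_norml sin_geN1 sin_le1.
- exact: sin_lipschitz.
Qed.
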